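(* Split-Identification can be solved in $k^{\mathcal{O}(k)}\cdot n^{\mathcal{O}(1)}$ time, where $n$ is the number of vertices of the input graph.
   Context: All graphs are finite, simple and undirected. An identification of two distinct vertices $u,v$ replaces them with a new vertex adjacent to every vertex of $(N(u)\cup N(v))\setminus\{u,v\}$. A split graph is a graph whose vertex set can be partitioned into a clique and an independent set. Split-Identification takes as input a graph $G$ and an integer $k\ge 0$ and asks whether $G$ can be transformed into a split graph by at most $k$ identifications. *)

(* Defs.v *)
From mathcomp Require Import all_boot.

Set Implicit Arguments.
Unset Strict Implicit.
Unset Printing Implicit Defensive.

Record sgraph := SGraph {
  vertex :> finType;
  adj : rel vertex;
  adj_sym : symmetric adj;
  adj_irr : irreflexive adj
}.

Section Identification.
Variables (G : sgraph) (u v : G).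

(* [None] is the new vertex. *)
Definition identify_vertex : finType :=
  option {x : G | (x != u) && (x != v)}.

Definition identify_adj (x y : identify_vertex) : bool :=
  match x, y with
  | Some x', Some y' => adj (val x') (val y')
  | Some x', None => adj u (val x') || adj v (val x')
  | None, Some y' => adj u (val y') || adj v (val y')
  | None, None => false
  end.

Lemma identify_adj_sym : symmetric identify_adj.
Proof. by case=> [x|] [y|] //=; rewrite adj_sym. Qed.

Lemma identify_adj_irr : irreflexive identify_adj.
Proof. by case=> [x|] //=; rewrite adj_irr. Qed.

Definition identify : sgraph := SGraph identify_adj_sym identify_adj_irr.

End Identification.

(* [identifications j G H]: H results from G by exactly j identifications. *)
Inductive identifications : nat -> sgraph -> sgraph -> Prop :=
| Identifications0 (G : sgraph) : identifications 0 G G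
| IdentificationsS (j : nat) (G H : sgraph) (u v : G) :
    u != v -> identifications j (identify u v) H -> identifications j.+1 G H.

Definition is_clique (G : sgraph) (A : {set G}) : Prop :=
  forall x y : G, x \in A -> y \in A -> x != y -> adj x y.

Definition is_independent (G : sgraph) (A : {set G}) : Prop :=
  forall x y : G, x \in A -> y \in A -> ~~ adj x y.

Definition is_split (G : sgraph) : Prop :=
  exists A : {set G}, is_clique A /\ is_independent (~: A).

Definition split_identification (G : sgraph) (k : nat) : Prop :=
  exists (j : nat) (H : sgraph),
    [/\ j <= k, identifications j G H & is_split H].

(* Model of computation: a unit-cost random access machine with structured   *)
(* control flow. A program mentions finitely many registers and accesses an  *)
(* unbounded memory by indirect addressing; registers and memory cells hold  *)
(* natural numbers. The only arithmetic is addition and truncated            *)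
(* subtraction, so one step lengthens the largest stored number by at most   *)
(* one bit and the unit-cost measure is polynomially related to Turing       *)
(* machine time.                                                             *)
Record state := State { reg : nat -> nat; mem : nat -> nat }.

Definition update (f : nat -> nat) (a x : nat) : nat -> nat :=
  fun b => if b == a then x else f b.

Definition set_reg (s : state) (r x : nat) : state :=
  State (update (reg s) r x) (mem s).

Definition set_mem (s : state) (a x : nat) : state :=
  State (reg s) (update (mem s) a x).

Inductive prog : Type :=
| Skip
| Const (r c : nat)
| Add (r r1 r2 : nat)
| Sub (r r1 r2 : nat)
| Fetch (r a : nat)
| Store (a r : nat)
| Seq (p q : prog)
| If (r : nat) (p q : prog)
| While (r : nat) (p : prog).

(* [exec p s t s']: started in s, p halts in s' after t steps; elementary    *)
(* instructions and tests of a register for being nonzero take one step.     *)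
Inductive exec : prog -> state -> nat -> state -> Prop :=
| ExecSkip s : exec Skip s 1 s
| ExecConst s r c : exec (Const r c) s 1 (set_reg s r c)
| ExecAdd s r r1 r2 :
    exec (Add r r1 r2) s 1 (set_reg s r (reg s r1 + reg s r2))
| ExecSub s r r1 r2 :
    exec (Sub r r1 r2) s 1 (set_reg s r (reg s r1 - reg s r2))
| ExecFetch s r a : exec (Fetch r a) s 1 (set_reg s r (mem s (reg s a)))
| ExecStore s a r : exec (Store a r) s 1 (set_mem s (reg s a) (reg s r))
| ExecSeq p q s1 s2 s3 t1 t2 :
    exec p s1 t1 s2 -> exec q s2 t2 s3 -> exec (Seq p q) s1 (t1 + t2) s3
| ExecIfT r p q s s' t :
    reg s r != 0 -> exec p s t s' -> exec (If r p q) s t.+1 s'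
| ExecIfF r p q s s' t :
    reg s r = 0 -> exec q s t s' -> exec (If r p q) s t.+1 s'
| ExecWhileF r p s : reg s r = 0 -> exec (While r p) s 1 s
| ExecWhileT r p s1 s2 s3 t1 t2 :
    reg s1 r != 0 -> exec p s1 t1 s2 -> exec (While r p) s2 t2 s3 ->
    exec (While r p) s1 (t1 + t2).+1 s3.

Lemma exec_det p s t1 s1 t2 s2 :
  exec p s t1 s1 -> exec p s t2 s2 -> t1 = t2 /\ s1 = s2.
Proof.
move=> e1; elim: e1 t2 s2 => {p s t1 s1};
  try by intros; match goal with e : exec _ _ _ _ |- _ => by inversion e end.
- move=> p q s1 s2 s3 t1 t2 _ IH1 _ IH2 t s e.
  inversion e as [| | | | | |? ? ? ? ? ? ? ep eq| | | |]; subst.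
  have [-> eqs] := IH1 _ _ ep; subst.
  by have [-> ->] := IH2 _ _ eq.
- move=> r p q s s' t nz _ IH t2 s2 e.
  inversion e as [| | | | | | |? ? ? ? ? ? _ ep|? ? ? ? ? ? z _| |]; subst.
    by have [-> ->] := IH _ _ ep.
  by rewrite z in nz.
- move=> r p q s s' t z _ IH t2 s2 e.
  inversion e as [| | | | | | |? ? ? ? ? ? nz _|? ? ? ? ? ? _ ep| |]; subst.
    by rewrite z in nz.
  by have [-> ->] := IH _ _ ep.
- move=> r p s z t2 s2 e.
  inversion e as [| | | | | | | | | |? ? ? ? ? ? ? nz _ _]; subst => //.
  by rewrite z in nz.
- move=> r p s1 s2 s3 t1 t2 nz _ IH1 _ IH2 t s e.
  inversion e as [| | | | | | | | |? ? ? z|? ? ? ? ? ? ? _ ep eq]; subst.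
    by rewrite z in nz.
  have [-> eqs] := IH1 _ _ ep; subst.
  by have [-> ->] := IH2 _ _ eq.
Qed.

(* Input (G, k) with G on {0, ..., n-1}: register 0 holds n, register 1      *)
(* holds k, the memory holds the row-major adjacency matrix of G.            *)
Definition input_state (n : nat) (e : rel 'I_n) (k : nat) : state :=
  State (fun r => nth 0 [:: n; k] r)
        (fun a => nth 0 [seq nat_of_bool (e i j) | i <- enum 'I_n,
                                                   j <- enum 'I_n] a).

(* On every input the program halts within the bound, and accepts (leaves a  *)
(* nonzero value in register 0) exactly on the yes-instances.                *)
Definition solves_in_time (p : prog) (Q : sgraph -> nat -> Prop)
    (T : nat -> nat -> nat) : Prop :=
  forall (n : nat) (e : rel 'I_n) (e_sym : symmetric e)
         (e_irr : irreflexive e) (k : nat),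
  exists (t : nat) (s : state),
    [/\ exec p (input_state e k) t s,
        reg s 0 != 0 <-> Q (SGraph e_sym e_irr) k
      & t <= T n k].

(* Main.v *)
Require Import Defs.
From mathcomp Require Import all_boot.
From mathcomp Require Import zify.
From Stdlib Require Import FunctionalExtensionality.
(* Imported again because [mem] is shadowed by ssrbool. *)
Import Defs.

(** A sequence of identifications amounts to a partition of the vertices, and
    one may assume that classes with several vertices occur on the clique side
    only: on the independent side keep one vertex per class and merge the
    others into any class of the clique side. So we look for an independent set
    whose complement Z is partitioned into pairwise adjacent classes, at least
    |Z| - k of them. At most 2k vertices of Z are not alone in their class.

    The degrees of the vertices alone predict, for one of n + 1 thresholds, the
    role of all vertices (independent, or alone in a class) up to 6k + 2 errors.
    Every contradiction between two predictions reveals an error, so O(k)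
    guesses among O(k) possibilities repair the prediction until the predicted
    independent set I and the predicted set K of lone vertices are independent
    and complete. At most one vertex of K is independent in the solution, which
    is guessed. Then I may be taken to be the independent side, and a class is
    guessed for each of the O(k) remaining vertices M. Finally a vertex of K
    that is nonadjacent to a class within M is not alone, so there are at most
    2k of these and their classes are guessed too; the other vertices of K are
    interchangeable: one of them, g, absorbs the rest of all classes that
    contain such vertices. All guesses but three (of a vertex or a threshold)
    are digits in base O(k) of a single number with O(k) digits, over which the
    program iterates. *)

Set Implicit Arguments.
Unset Strict Implicit.
Unset Printing Implicit Defensive.

(** * A loop language and its compilation *)

(** Origin of the constants: the at most [2 * k] clique-side vertices that share a class are
    mispredicted by every threshold, and the counting argument adds [4 * k + 2]; the sum is
    [budget]. Labels up to [budget] are reserved for classes inside M, the next [2 * k] for classes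
    that meet K in nonadjacent vertices only, and [2 * budget] is the class of g; thanks to these
    ranges, labels alone reveal which classes lie inside M. A repair reads two digits (the wrong
    endpoint, its correct side), a relabelled vertex one. There are two rounds of [budget] repairs,
    because moving the guessed vertex of K to the independent side may create edges there; hence
    [6 * budget] digits. No guess has to be trusted: an accepted labelling is checked in full and is
    itself a solution, so the structural results serve completeness only. Nor need the program be
    efficient: a power of the number of guesses is still k^O(k), so division by repeated subtraction
    and a crude common bound on all loop counts are good enough. *)

Inductive expr : Type :=
| Reg (r : nat)
| Lit (c : nat)
| Plus (a b : expr)
| Minus (a b : expr)
| Read (a : expr).

Inductive cmd : Type :=
| Nop
| Asn (r : nat) (e : expr)
| Write (a e : expr)
| Then (c d : cmd)
| Cond (e : expr) (c d : cmd)
| For (i b : nat) (c : cmd).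

Fixpoint eval (e : expr) (s : state) : nat :=
  match e with
  | Reg r => reg s r
  | Lit c => c
  | Plus a b => eval a s + eval b s
  | Minus a b => eval a s - eval b s
  | Read a => mem s (eval a s)
  end.

Definition incr (i : nat) (s : state) : state := set_reg s i (reg s i).+1.

(** The number of rounds of [For] is read once, on entry, so every command terminates and its
    meaning is a total function. *)
Fixpoint sem (c : cmd) (s : state) : state :=
  match c with
  | Nop => s
  | Asn r e => set_reg s r (eval e s)
  | Write a e => set_mem s (eval a s) (eval e s)
  | Then c d => sem d (sem c s)
  | Cond e c d => if eval e s != 0 then sem c s else sem d s
  | For i b c => iter (reg s b) (fun s => incr i (sem c s)) (set_reg s i 0)
  end.

Fixpoint assigned (c : cmd) : seq nat :=
  match c with
  | Nop | Write _ _ => [::]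
  | Asn r _ => [:: r]
  | Then c d | Cond _ c d => assigned c ++ assigned d
  | For i _ c => i :: assigned c
  end.

Fixpoint writes (c : cmd) : bool :=
  match c with
  | Nop | Asn _ _ => false
  | Write _ _ => true
  | Then c d | Cond _ c d => writes c || writes d
  | For _ _ c => writes c
  end.

Fixpoint loop_bounds (c : cmd) : seq nat :=
  match c with
  | Nop | Asn _ _ | Write _ _ => [::]
  | Then c d | Cond _ c d => loop_bounds c ++ loop_bounds d
  | For _ b c => b :: loop_bounds c
  end.

Lemma reg_sem_frame c s r : r \notin assigned c -> reg (sem c s) r = reg s r.
Proof.
elim: c s => //= [r' e|c IHc d IHd|e c IHc d IHd|i b c IHc] s.
- by rewrite inE /update => /negbTE ->.
- by rewrite mem_cat negb_or => /andP [rc rd]; rewrite IHd // IHc.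
- by rewrite mem_cat negb_or => /andP [rc rd]; case: ifP => _; rewrite ?IHd ?IHc.
- rewrite inE negb_or => /andP [/negbTE ri rc].
  by elim: (reg s b) => [|m IH] /=; rewrite /update ri ?IHc.
Qed.

Lemma mem_sem_frame c s : ~~ writes c -> mem (sem c s) = mem s.
Proof.
elim: c s => //= [c IHc d IHd|e c IHc d IHd|i b c IHc] s.
- by rewrite negb_or => /andP [wc wd]; rewrite IHd // IHc.
- by rewrite negb_or => /andP [wc wd]; case: ifP => _; rewrite ?IHd ?IHc.
- by move=> wc; elim: (reg s b) => [|m IH] //=; rewrite IHc.
Qed.

(** * Translation to the random access machine and its cost *)

Fixpoint compile_expr (e : expr) (t : nat) : prog :=
  match e with
  | Reg r => Seq (Const t 0) (Add t t r)
  | Lit c => Const t c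
  | Plus a b => Seq (compile_expr a t) (Seq (compile_expr b t.+1) (Add t t t.+1))
  | Minus a b => Seq (compile_expr a t) (Seq (compile_expr b t.+1) (Sub t t t.+1))
  | Read a => Seq (compile_expr a t) (Fetch t t)
  end.

(** Scratch registers start at [t]. In a loop, [t] receives a copy of the bound and counts down,
    [t.+1] holds the constant 1, and the body is compiled above both, so that nested loops do not
    interfere. *)
Fixpoint compile (c : cmd) (t : nat) : prog :=
  match c with
  | Nop => Skip
  | Asn r e => Seq (compile_expr e t) (Seq (Const r 0) (Add r r t))
  | Write a e =>
      Seq (compile_expr a t) (Seq (compile_expr e t.+1) (Store t t.+1))
  | Then c d => Seq (compile c t) (compile d t)
  | Cond e c d => Seq (compile_expr e t) (If t (compile c t) (compile d t))
  | For i b c =>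
      Seq (Const t 0) (Seq (Add t t b) (Seq (Const i 0)
        (While t (Seq (compile c t.+2)
          (Seq (Const t.+1 1) (Seq (Add i i t.+1) (Sub t t t.+1)))))))
  end.

Fixpoint expr_time (e : expr) : nat :=
  match e with
  | Reg _ => 2
  | Lit _ => 1
  | Plus a b | Minus a b => expr_time a + expr_time b + 1
  | Read a => expr_time a + 1
  end.

(** [U] stands for a bound on all loop counts, and a conditional is charged for both branches. Each
    round of a loop pays 4 steps for the test and the counters; the final 4 are three
    initializations and the failing test. *)
Fixpoint cmd_time (U : nat) (c : cmd) : nat :=
  match c with
  | Nop => 1
  | Asn _ e => expr_time e + 2
  | Write a e => expr_time a + expr_time e + 1
  | Then c d => cmd_time U c + cmd_time U d
  | Cond e c d => expr_time e + cmd_time U c + cmd_time U d + 1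
  | For _ _ c => U * (cmd_time U c + 4) + 4
  end.

Fixpoint expr_below (m : nat) (e : expr) : bool :=
  match e with
  | Reg r => r < m
  | Lit _ => true
  | Plus a b | Minus a b => expr_below m a && expr_below m b
  | Read a => expr_below m a
  end.

Fixpoint cmd_below (m : nat) (c : cmd) : bool :=
  match c with
  | Nop => true
  | Asn r e => (r < m) && expr_below m e
  | Write a e => expr_below m a && expr_below m e
  | Then c d => cmd_below m c && cmd_below m d
  | Cond e c d => [&& expr_below m e, cmd_below m c & cmd_below m d]
  | For i b c => [&& i < m, b < m & cmd_below m c]
  end.

Section Compile.
(* Registers below [m] belong to the source program, the others are scratch. *)
Variable m : nat.

Definition agree (s s' : state) : Prop :=
  (forall r, r < m -> reg s r = reg s' r) /\ mem s =1 mem s'.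

Lemma compile_expr_correct e t s1 s :
  m <= t -> expr_below m e -> agree s1 s ->
  exists s2, [/\ exec (compile_expr e t) s1 (expr_time e) s2,
    reg s2 t = eval e s, forall r, r < t -> reg s2 r = reg s1 r
    & mem s2 = mem s1].
Proof.
elim: e t s1 => /= [r|c|a IHa b IHb|a IHa b IHb|a IHa] t s1 lemt.
- move=> ltr [Ar Am]; eexists; split.
  + exact: (ExecSeq (ExecConst _ _ _) (ExecAdd _ _ _ _)).
  + by rewrite /= /update eqxx Ar // (_ : (r == t) = false) //; lia.
  + move=> r' lt_r' /=; rewrite /update (_ : (r' == t) = false) //; lia.
  + by [].
- move=> _ _; eexists; split; first exact: ExecConst.
  + by rewrite /= /update eqxx.
  + move=> r' lt_r' /=; rewrite /update (_ : (r' == t) = false) //; lia.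
  + by [].
- move=> /andP [ba bb] A; have [s2 [E2 V2 F2 M2]] := IHa t s1 lemt ba A.
  have A2 : agree s2 s.
    split; last by rewrite M2; exact: A.2.
    by move=> r ltr; rewrite F2 ?A.1 //; lia.
  have [s3 [E3 V3 F3 M3]] := IHb t.+1 s2 (leqW lemt) bb A2.
  eexists; split.
  + by rewrite -addnA; apply: ExecSeq E2 (ExecSeq E3 (ExecAdd _ _ _ _)).
  + by rewrite /= /update eqxx V3 F3 // V2.
  + move=> r ltr /=; rewrite /update (_ : (r == t) = false); last lia.
    by rewrite F3 ?F2 //; lia.
  + by rewrite /= M3.
- move=> /andP [ba bb] A; have [s2 [E2 V2 F2 M2]] := IHa t s1 lemt ba A.
  have A2 : agree s2 s.
    split; last by rewrite M2; exact: A.2.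
    by move=> r ltr; rewrite F2 ?A.1 //; lia.
  have [s3 [E3 V3 F3 M3]] := IHb t.+1 s2 (leqW lemt) bb A2.
  eexists; split.
  + by rewrite -addnA; apply: ExecSeq E2 (ExecSeq E3 (ExecSub _ _ _ _)).
  + by rewrite /= /update eqxx V3 F3 // V2.
  + move=> r ltr /=; rewrite /update (_ : (r == t) = false); last lia.
    by rewrite F3 ?F2 //; lia.
  + by rewrite /= M3.
- move=> ba A; have [s2 [E2 V2 F2 M2]] := IHa t s1 lemt ba A.
  eexists; split; first by apply: ExecSeq E2 (ExecFetch _ _ _).
  + by rewrite /= /update eqxx V2 M2 A.2.
  + move=> r ltr /=; rewrite /update (_ : (r == t) = false); last lia.
    exact: F2.
  + by rewrite /= M2.
Qed.

Lemma agree_frame t s1 s2 s : m <= t -> agree s1 s ->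
  (forall r, r < t -> reg s2 r = reg s1 r) -> mem s2 = mem s1 -> agree s2 s.
Proof.
move=> lemt A F M; split; last by rewrite M; exact: A.2.
by move=> r ltr; rewrite F ?A.1 //; lia.
Qed.

(* Loop bounds that the program never assigns keep their initial value, so   *)
(* their initial values bound the running time.                              *)
Lemma compile_correct U c t s1 s :
  m <= t -> cmd_below m c -> agree s1 s ->
  (forall b, b \in loop_bounds c -> b \notin assigned c) ->
  (forall b, b \in loop_bounds c -> reg s b <= U) ->
  exists d s2, [/\ exec (compile c t) s1 d s2, agree s2 (sem c s),
    forall r, m <= r -> r < t -> reg s2 r = reg s1 r & d <= cmd_time U c].
Proof.
elim: c t s1 s => [|r e|a e|c IHc d IHd|e c IHc d IHd|i b c IHc] t s1 s lemt /=.
- by move=> _ A _ _; exists 1, s1; split=> //; apply: ExecSkip.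
- move=> /andP [ltr be] A _ _.
  have [s2 [E2 V2 F2 M2]] := compile_expr_correct lemt be A.
  eexists; eexists; split.
  + exact: ExecSeq E2 (ExecSeq (ExecConst _ _ _) (ExecAdd _ _ _ _)).
  + have A2 := agree_frame lemt A F2 M2.
    split; last exact: A2.2.
    move=> r' ltr' /=; rewrite /update eqxx; case: eqP => // _; last exact: A2.1.
    by rewrite (_ : (t == r) = false) //; lia.
  + move=> r' le_r' lt_r' /=; rewrite /update (_ : (r' == r) = false); last lia.
    exact: F2.
  + by [].
- move=> /andP [ba be] A _ _.
  have [s2 [E2 V2 F2 M2]] := compile_expr_correct lemt ba A.
  have A2 := agree_frame lemt A F2 M2.
  have [s3 [E3 V3 F3 M3]] := compile_expr_correct (leqW lemt) be A2.
  have A3 := agree_frame (leqW lemt) A2 F3 M3.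
  eexists; eexists; split.
  + exact: ExecSeq E2 (ExecSeq E3 (ExecStore _ _ _)).
  + split; first exact: A3.1.
    move=> x /=; rewrite V3 F3 // V2 /update; case: eqP => // _; exact: A3.2.
  + by move=> r ler ltr /=; rewrite F3 ?F2 //; lia.
  + lia.
- move=> /andP [bc bd] A SA SU.
  have [b lb|b lb|dc [s2 [E2 A2 F2 T2]]] := IHc t s1 s lemt bc A.
  + have := SA b; rewrite !mem_cat lb => /(_ isT).
    by rewrite negb_or => /andP [].
  + by apply: SU; rewrite mem_cat lb.
  have [b lb|b lb|dd [s3 [E3 A3 F3 T3]]] := IHd t s2 _ lemt bd A2.
  + have := SA b; rewrite !mem_cat lb orbT => /(_ isT).
    by rewrite negb_or => /andP [].
  + rewrite reg_sem_frame; first by apply: SU; rewrite mem_cat lb orbT.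
    have := SA b; rewrite !mem_cat lb orbT => /(_ isT).
    by rewrite negb_or => /andP [].
  exists (dc + dd), s3; split=> //.
  + exact: ExecSeq E2 E3.
  + by move=> r ler ltr; rewrite F3 ?F2.
  + lia.
- move=> /and3P [be bc bd] A SA SU.
  have [s2 [E2 V2 F2 M2]] := compile_expr_correct lemt be A.
  have A2 := agree_frame lemt A F2 M2.
  case: ifP => [nz|/negbFE/eqP z].
  + have [b lb|b lb|dc [s3 [E3 A3 F3 T3]]] := IHc t s2 s lemt bc A2.
    * have := SA b; rewrite !mem_cat lb => /(_ isT).
      by rewrite negb_or => /andP [].
    * by apply: SU; rewrite mem_cat lb.
    exists (expr_time e + dc.+1), s3; split=> //.
    * by apply: ExecSeq E2 (ExecIfT _ _ E3); rewrite V2.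
    * by move=> r ler ltr; rewrite F3 ?F2.
    * lia.
  + have [b lb|b lb|dc [s3 [E3 A3 F3 T3]]] := IHd t s2 s lemt bd A2.
    * have := SA b; rewrite !mem_cat lb orbT => /(_ isT).
      by rewrite negb_or => /andP [].
    * by apply: SU; rewrite mem_cat lb orbT.
    exists (expr_time e + dc.+1), s3; split=> //.
    * by apply: ExecSeq E2 (ExecIfF _ _ E3); rewrite V2.
    * by move=> r ler ltr; rewrite F3 ?F2.
    * lia.
- move=> /and3P [lti ltb bc] A SA SU.
  set body := Seq (compile c t.+2) _.
  set f := fun s => incr i (sem c s).
  have SAc b' : b' \in loop_bounds c -> (b' != i) && (b' \notin assigned c).
    by move=> lb; have := SA b'; rewrite !inE lb orbT negb_or => /(_ isT).
  have ti : (t == i) = false by apply: gtn_eqF; apply: leq_trans lti lemt.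
  have t1i : (t.+1 == i) = false.
    by apply: gtn_eqF; apply: leqW; apply: leq_trans lti lemt.
  have tt1 : (t == t.+1) = false by apply: ltn_eqF.
  (* The induction is on the count [q] left in scratch register [t], not on the source counter [i],
     which the body may assign. *)
  have loop q s1' s' : agree s1' s' ->
      (forall b', b' \in loop_bounds c -> reg s' b' <= U) -> reg s1' t = q ->
      exists d s2, [/\ exec (While t body) s1' d s2, agree s2 (iter q f s'),
        forall r, m <= r -> r < t -> reg s2 r = reg s1' r
        & d <= q * (cmd_time U c + 4) + 1].
    elim: q s1' s' => [|q IHq] s1' s' A' SU' rt.
      by exists 1, s1'; split=> //; apply: ExecWhileF.
    have [b' /SAc/andP [_ ->]//|b' lb|dc [s2 [E2 A2 F2 T2]]] :=
        IHc t.+2 s1' s' (leqW (leqW lemt)) bc A'; first exact: SU'.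
    pose s3 := set_reg s2 t.+1 1.
    pose s4 := set_reg s3 i (reg s3 i + reg s3 t.+1).
    pose s5 := set_reg s4 t (reg s4 t - reg s4 t.+1).
    have t5 : reg s5 t = q.
      rewrite /s5 /s4 /s3 /= /update !eqxx ti t1i tt1 F2 ?rt ?subn1 //.
    have A5 : agree s5 (f s').
      split; last exact: A2.2.
      move=> r ltr; rewrite /s5 /s4 /s3 /f /= /update !eqxx.
      rewrite (ltn_eqF (leq_trans ltr lemt)) [i == _]eq_sym t1i.
      rewrite (ltn_eqF (leqW (leq_trans ltr lemt))).
      by case: eqP => _; rewrite A2.1 ?addn1.
    have [|d [s6 [E6 A6 F6 T6]]] := IHq _ _ A5 _ t5.
      move=> b' lb /=; have /andP [/negbTE bi bc'] := SAc _ lb.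
      by rewrite /update bi reg_sem_frame // SU'.
    exists (dc + (1 + (1 + 1)) + d).+1, s6; split.
    + apply: ExecWhileT E6; first by rewrite rt.
      exact: ExecSeq E2 (ExecSeq (ExecConst _ _ _)
               (ExecSeq (ExecAdd _ _ _ _) (ExecSub _ _ _ _))).
    + by rewrite iterSr.
    + move=> r ler ltr; rewrite F6 // /s5 /s4 /s3 /= /update.
      rewrite (ltn_eqF ltr) (ltn_eqF (leqW ltr)).
      by rewrite (gtn_eqF (leq_trans lti ler)) F2 // !ltnS ltnW // ltnW.
    + lia.
  pose s3 := set_reg s1 t 0.
  pose s4 := set_reg s3 t (reg s3 t + reg s3 b).
  pose s5 := set_reg s4 i 0.
  have t5 : reg s5 t = reg s b.
    rewrite /s5 /s4 /s3 /= /update !eqxx ti (ltn_eqF (leq_trans ltb lemt)).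
    by rewrite A.1.
  have A5 : agree s5 (set_reg s i 0).
    split; last exact: A.2.
    move=> r ltr; rewrite /s5 /s4 /s3 /= /update; case: eqP => // _.
    by rewrite (ltn_eqF (leq_trans ltr lemt)) A.1.
  have [|d [s6 [E6 A6 F6 T6]]] := loop _ _ _ A5 _ t5.
    move=> b' lb /=; have /andP [/negbTE bi bc'] := SAc _ lb.
    by rewrite /update bi SU // inE lb orbT.
  exists (1 + (1 + (1 + d))), s6; split=> //.
  + exact: ExecSeq (ExecConst _ _ _) (ExecSeq (ExecAdd _ _ _ _)
             (ExecSeq (ExecConst _ _ _) E6)).
  + move=> r ler ltr; rewrite F6 // /s5 /s4 /s3 /= /update.
    by rewrite (ltn_eqF ltr) (gtn_eqF (leq_trans lti ler)).
  + have: reg s b <= U by apply: SU; rewrite inE eqxx.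
    move=> leU; have := leq_mul leU (leqnn (cmd_time U c + 4)); lia.
Qed.

End Compile.

(** As [U.+2] is at least 2, one more factor absorbs a sum, and a constant [q] is at most
    [2 ^ q]. *)
Lemma cmd_time_poly c : exists E, forall U, cmd_time U c <= U.+2 ^ E.
Proof.
have pow U q : q <= U.+2 ^ q.
  case: q => // q; apply: (@leq_trans (2 ^ q.+1)); last by rewrite leq_exp2r.
  exact/ltnW/ltn_expl.
have sum2 U x y E1 E2 : x <= U.+2 ^ E1 -> y <= U.+2 ^ E2 ->
    x + y <= U.+2 ^ (E1 + E2).+1.
  move=> lx ly; rewrite expnS.
  have : x <= U.+2 ^ (E1 + E2) by apply: leq_trans lx _; rewrite leq_exp2l // leq_addr.
  have : y <= U.+2 ^ (E1 + E2) by apply: leq_trans ly _; rewrite leq_exp2l // leq_addl.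
  set p := _ ^ (_ + _); nia.
have cst q : exists E, forall U, q <= U.+2 ^ E by exists q => U; exact: pow.
have add (f g : nat -> nat) : (exists E, forall U, f U <= U.+2 ^ E) ->
    (exists E, forall U, g U <= U.+2 ^ E) ->
    exists E, forall U, f U + g U <= U.+2 ^ E.
  by move=> [E1 h1] [E2 h2]; exists (E1 + E2).+1 => U; exact: sum2.
elim: c => /= [|r e|a e|c IHc d IHd|e c IHc d IHd|i b c IHc].
- exact: cst.
- exact: cst.
- exact: cst.
- exact: add.
- exact: (add _ _ (add _ _ (add _ _ (cst (expr_time e)) IHc) IHd) (cst 1)).
- suff h : exists E, forall U, U * (cmd_time U c + 4) <= U.+2 ^ E.
    exact: (add _ _ h (cst 4)).
  have [E hE] := add _ _ IHc (cst 4).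
  exists E.+1 => U; rewrite expnS; apply: leq_mul => //; lia.
Qed.

(** * Identifications and partitions *)

(** The fibers of [F] are the sets merged into one vertex, and [A] marks those on the clique side.
    Merging m vertices takes m - 1 identifications, hence the last clause. Edges inside a fiber
    disappear, so the first two clauses concern distinct fibers only. *)
Definition split_quotient (G : sgraph) (k : nat) : Prop :=
  exists (T : finType) (F : G -> T) (A : {set T}),
    [/\ forall x y, F x \in A -> F y \in A -> F x != F y ->
          exists x' y', [/\ F x' = F x, F y' = F y & adj x' y'],
        forall x y, F x \notin A -> F y \notin A -> F x != F y -> ~~ adj x y
      & #|G| <= k + #|F @: G|].

Lemma card_identify (G : sgraph) (u v : G) : u != v ->
  #|identify u v|.+1 = #|G|.
Proof.
move=> uv; rewrite card_option card_sig.
rewrite (cardD1 u G) (cardD1 v [predD1 G & u]) !inE eq_sym uv /= !add1n; congr S; congr S.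
by apply: eq_card => x; rewrite !inE andbT andbC.
Qed.

Lemma identifications_split_quotient (G H : sgraph) j :
  identifications j G H -> is_split H -> split_quotient G j.
Proof.
elim=> {j G H} [G [A [cA iA]]|j G H u v uv _ IH /IH [T [F [A [Fadj Find Fcard]]]]].
  exists G, id, A; split=> //.
  - by move=> x y xA yA xy; exists x, y; split=> //; apply: cA.
  - by move=> x y xA yA _; apply: iA; rewrite in_setC.
  - by rewrite add0n card_imset.
pose q (x : G) : identify u v := insub x.
have qval (x' : {x : G | (x != u) && (x != v)}) : q (val x') = Some x'.
  by rewrite /q valK.
have qu : q u = None by rewrite /q insubF // eqxx.
have qv : q v = None by rewrite /q insubF // eqxx andbF.
have qN x : q x = None -> (x == u) || (x == v).
  by rewrite /q; case: insubP => //; rewrite negb_and !negbK.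
have qS x x' : q x = Some x' -> x = val x'.
  by rewrite /q; case: insubP => // w _ <- [->].
have qsurj x' : exists x, q x = x'.
  by case: x' => [x'|]; [exists (val x')|exists u].
exists T, (F \o q), A; split=> /=.
- move=> x y xA yA xy; have [x' [y' [Fx Fy]]] := Fadj _ _ xA yA xy.
  case: x' Fx => [x'|] Fx; case: y' Fy => [y'|] Fy //=.
  + by exists (val x'), (val y'); rewrite !qval.
  + by case/orP=> a; [exists (val x'), u|exists (val x'), v];
      rewrite !qval ?qu ?qv; split=> //; rewrite adj_sym.
  + by case/orP=> a; [exists u, (val y')|exists v, (val y')];
      rewrite !qval ?qu ?qv.
- move=> x y xA yA xy; have := Find _ _ xA yA xy; apply: contra => a.
  case qx: (q x) => [x'|]; case qy: (q y) => [y'|] /=.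
  + by rewrite -(qS _ _ qx) -(qS _ _ qy).
  + rewrite -(qS _ _ qx) adj_sym [adj v x]adj_sym.
    by case/orP: (qN _ qy) => /eqP E; rewrite -E a ?orbT.
  + rewrite -(qS _ _ qy).
    by case/orP: (qN _ qx) => /eqP E; rewrite -E a ?orbT.
  + by move: xy; rewrite qx qy eqxx.
- have -> : (F \o q) @: G = F @: identify u v.
    apply/setP=> z; apply/imsetP/imsetP => [[x _ ->]|[x' _ ->]].
      by exists (q x).
    by have [x <-] := qsurj x'; exists x.
  by rewrite -(card_identify uv) addSn ltnS.
Qed.

(** While [F] is not injective, identifying two vertices of equal label uses one unit of [k] and one
    vertex and keeps the image of [F]. Once [F] is injective, [G] itself is split, with clique side
    [F @^-1: A]. *)
Lemma split_quotient_identifications (G : sgraph) k :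
  split_quotient G k -> split_identification G k.
Proof.
elim: k G => [|k IH] G [T [F [A [Fadj Find Fcard]]]];
  have [Finj|] := boolP (injectiveb F).
1,3: move/injectiveP in Finj; exists 0, G; split=> //; first exact: Identifications0;
  exists (F @^-1: A); split=> x y; rewrite !inE => xA yA;
  [move=> xy; have [|x' [y' [/Finj -> /Finj -> //]]] := Fadj _ _ xA yA;
     by rewrite (inj_eq Finj)
  |have [->|xy] := eqVneq x y; [by rewrite adj_irr|apply: Find => //; by rewrite (inj_eq Finj)]].
- case/injectivePn=> x [y xy Fxy].
  move: Fcard; rewrite add0n leqNgt; case/negP.
  rewrite ltn_neqAle leq_imset_card andbT; apply/negP => /imset_injP inj.
  by case/eqP: xy; apply: inj.
- case/injectivePn=> u [v uv Fuv].
  suff: split_quotient (identify u v) k.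
    by case/IH=> j [H [jk idj sH]]; exists j.+1, H; split=> //; apply: IdentificationsS idj.
  pose q (x : G) : identify u v := insub x.
  pose F' (x : identify u v) := if x is Some x' then F (val x') else F u.
  have F'q x : F' (q x) = F x.
    rewrite /q; case: insubP => [w _ <- //|].
    by rewrite negb_and !negbK => /orP [/eqP->|/eqP->].
  have qval (x' : {x : G | (x != u) && (x != v)}) : q (val x') = Some x'.
    by rewrite /q valK.
  have adjq x y : F x != F y -> adj x y -> adj (q x) (q y).
    rewrite /q; case: insubP => [x' _ <-|]; case: insubP => [y' _ <-|] //=.
    + rewrite negb_and !negbK => /orP [/eqP->|/eqP->] _;
      by rewrite adj_sym => ->; rewrite ?orbT.
    + by rewrite negb_and !negbK => /orP [/eqP->|/eqP->] _ ->; rewrite ?orbT.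
    + rewrite !negb_and !negbK => /orP [/eqP->|/eqP->] /orP [/eqP->|/eqP->];
      by rewrite ?Fuv eqxx.
  have adjF' x y : adj x y -> exists x' y', [/\ F x' = F' x, F y' = F' y & adj x' y'].
    case: x => [x|]; case: y => [y|] //=.
    + by exists (val x), (val y).
    + by case/orP=> a; [exists (val x), u|exists (val x), v]; rewrite adj_sym.
    + by case/orP=> a; [exists u, (val y)|exists v, (val y)].
  have qsurj x' : exists x, q x = x'.
    by case: x' => [x'|]; [exists (val x')|exists u; rewrite /q insubF // eqxx].
  exists T, F', A; split.
  + move=> x y xA yA xy.
    have [x0 ex] := qsurj x; have [y0 ey] := qsurj y; subst x y.
    rewrite !F'q in xA yA xy *.
    have [x' [y' [Fx Fy a]]] := Fadj _ _ xA yA xy.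
    by exists (q x'), (q y'); rewrite !F'q; split=> //; apply: adjq => //; rewrite Fx Fy.
  + move=> x y xA yA xy; apply/negP => /adjF' [x' [y' [Fx Fy]]]; apply/negP.
    by apply: Find; rewrite ?Fx ?Fy.
  + have -> : F' @: identify u v = F @: G.
      apply/setP=> z; apply/imsetP/imsetP => [[x' _ ->]|[x _ ->]].
        by have [x <-] := qsurj x'; exists x.
      by exists (q x).
    by move: Fcard; rewrite -(card_identify uv) addSn ltnS.
Qed.

(** * Solutions: an independent set and clique classes on its complement *)

Section Valid.
Variables (V : finType) (e : rel V).

Definition independent (A : {set V}) := forall x y, x \in A -> y \in A -> ~~ e x y.

(* The vertices of [Z] form the clique side, with the fibers of [f] on [Z]   *)
(* as the identified classes; no identification takes place outside [Z].     *)
Definition clique_classes (T : eqType) (Z : {set V}) (f : V -> T) : Prop :=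
  forall x y, x \in Z -> y \in Z -> f x != f y ->
    exists x' y', [/\ x' \in Z, y' \in Z, f x' = f x, f y' = f y & e x' y'].

Definition solution (T : finType) (k : nat) (Z : {set V}) (f : V -> T) : Prop :=
  [/\ independent (~: Z), clique_classes Z f & #|Z| <= k + #|f @: Z|].

(* If [X] may join the independent side, the rest of every class that meets  *)
(* [X] is merged into one class that does not, at no extra cost.             *)
Lemma solution_setD (T : finType) k Z (f : V -> T) (X : {set V}) :
  solution k Z f -> X \subset Z -> independent (~: Z :|: X) ->
  exists f' : V -> T, solution k (Z :\: X) f'.
Proof.
move=> [Zi Zc Zk] XZ ZXi.
(* At most [#|X|] classes meet [X]; losing them is paid for by the [#|X|] vertices that leave the
   clique side. *)
have cardX : #|f @: Z| <= #|f @: Z :\: f @: X| + #|X|.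
  have /= := leq_imset_card f X.
  have := cardsID (f @: X) (f @: Z).
  have := subset_leq_card (subsetIr (f @: Z) (f @: X)); lia.
have cardZX : #|Z :\: X| + #|X| = #|Z|.
  by rewrite -(cardsID X Z) (setIidPr XZ) addnC.
have iZX : independent (~: (Z :\: X)) by rewrite setCD.
have inD x : f x \notin f @: X -> x \notin X.
  by apply: contra => xX; apply: imset_f.
(* If every class meets [X], then [#|f @: Z| <= #|X|], so at most [k] vertices remain in [Z :\: X]
   and may form a single class. The vertex [v0] only supplies a label in [T]. *)
have [E|[c]] := set_0Vmem (f @: Z :\: f @: X).
  case: (pickP (fun _ : V => true)) => [v0 _|V0]; last first.
    exists f; split=> //; first by move=> x; have := V0 x.
    by rewrite E cards0 in cardX; lia.
  exists (fun=> f v0); split=> //; first by move=> x y; rewrite eqxx.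
  by rewrite E cards0 in cardX; lia.
rewrite inE => /andP [cX /imsetP [z zZ ez]]; subst c.
pose f' v := if f v \in f @: X then f z else f v.
have f'S : f @: Z :\: f @: X \subset f' @: (Z :\: X).
  apply/subsetP=> c /setDP [/imsetP [x xZ ->] fx].
  apply/imsetP; exists x; first by rewrite inE xZ inD.
  by rewrite /f' (negbTE fx).
have f'P x : x \in Z -> exists x0, [/\ x0 \in Z, f x0 \notin f @: X & f x0 = f' x].
  rewrite /f'; case: ifP => [fx|/negbT fx] xZ; first by exists z.
  by exists x.
have f'E x : f x \notin f @: X -> f' x = f x by rewrite /f' => /negbTE ->.
exists f'; split=> //.
  move=> x y /setDP [xZ _] /setDP [yZ _] xy.
  have [x0 [x0Z fx0 ex]] := f'P _ xZ; have [y0 [y0Z fy0 ey]] := f'P _ yZ.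
  rewrite -ex -ey in xy *.
  have [x' [y' [x'Z y'Z ex' ey' a]]] := Zc _ _ x0Z y0Z xy.
  exists x', y'; rewrite !inE x'Z y'Z !f'E ?ex' ?ey' //.
  by split=> //; rewrite andbT; apply: inD; rewrite ?ex' ?ey'.
have := subset_leq_card f'S; lia.
Qed.

End Valid.

(* On the independent side one representative of each class suffices: the    *)
(* other vertices move to an arbitrary class of the clique side for the cost *)
(* that identifying them had before.                                         *)
Lemma split_quotient_solution (G : sgraph) k :
  split_quotient G k -> exists (T : finType) (Z : {set G}) (f : G -> T),
    solution (@adj G) k Z f.
Proof.
case=> T [F [A [Fadj Find Fcard]]]; exists T.
case: (pickP (fun _ : G => true)) => [v0 _|G0]; last first.
  have {}G0 (x : G) : False by have := G0 x.
  exists setT, F; split; [by move=> x; case: (G0 x)|by move=> x; case: (G0 x)|].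
  by rewrite eq_card0 // => x; case: (G0 x).
pose r x := odflt x [pick y | F y == F x].
have Fr x : F (r x) = F x.
  by rewrite /r; case: pickP => [y /eqP|] //.
have rE x y : F x = F y -> r x = r y.
  rewrite /r => ->; case: pickP => // /(_ y); by rewrite eqxx.
pose Z0 := F @^-1: A; pose W := [set x | (F x \notin A) && (r x == x)].
have cardW : #|G| <= k + #|F @: Z0| + #|W|.
  apply: leq_trans Fcard _; rewrite -addnA leq_add2l.
  apply: leq_trans (_ : #|F @: Z0 :|: F @: W| <= _).
    apply: subset_leq_card; apply/subsetP => c /imsetP [x _ ->].
    rewrite inE; have [xA|xA] := boolP (F x \in A).
      by rewrite imset_f // inE.
    apply/orP; right; apply/imsetP; exists (r x); last by rewrite Fr.
    by rewrite inE Fr xA /=; apply/eqP/rE; rewrite Fr.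
  have := cardsUI (F @: Z0) (F @: W); have /= := leq_imset_card F W; lia.
have cardZ : #|~: W| + #|W| = #|G| by rewrite addnC cardsC.
have iW : independent (@adj G) W.
  move=> x y; rewrite !inE => /andP [xA /eqP rx] /andP [yA /eqP ry].
  have [E|] := eqVneq (F x) (F y); last exact: Find.
  by rewrite -rx -ry (rE _ _ E) adj_irr.
(* With an empty clique side there is no class to receive the duplicates; but then [cardW] leaves at
   most [k] of them, and they form one class. *)
have [E|[z]] := set_0Vmem Z0.
  exists (~: W), (fun=> F v0); split; first by rewrite setCK.
    by move=> x y; rewrite eqxx.
  by move: cardW; rewrite E imset0 cards0; lia.
rewrite inE => zA.
pose f x := if F x \in A then F x else F z.
have fP x : exists x0, [/\ F x0 \in A & F x0 = f x].
  by rewrite /f; case: ifP => xA; [exists x|exists z].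
have fE x : F x \in A -> f x = F x by rewrite /f => ->.
have inZ x : F x \in A -> x \in ~: W by rewrite !inE => ->.
exists (~: W), f; split; first by rewrite setCK.
  move=> x y _ _; have [x0 [x0A <-]] := fP x; have [y0 [y0A <-]] := fP y => xy.
  have [x' [y' [ex' ey' a]]] := Fadj _ _ x0A y0A xy.
  by exists x', y'; rewrite !inZ ?fE ?ex' ?ey'.
suff /subset_leq_card : F @: Z0 \subset f @: (~: W) by lia.
apply/subsetP => c /imsetP [x]; rewrite inE => xA ->.
by apply/imsetP; exists x; rewrite ?fE ?inZ.
Qed.

Lemma split_identification_solution (G : sgraph) k :
  split_identification G k -> exists (T : finType) (Z : {set G}) (f : G -> T),
    solution (@adj G) k Z f.
Proof.
case=> j [H [jk idj sH]]; apply: split_quotient_solution.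
have [T [F [A [Fadj Find Fcard]]]] := identifications_split_quotient idj sH.
by exists T, F, A; split=> //; lia.
Qed.

Lemma solution_split_identification (G : sgraph) k (T : finType) (Z : {set G})
    (f : G -> T) :
  solution (@adj G) k Z f -> split_identification G k.
Proof.
move=> [Zi Zc Zk]; apply: split_quotient_identifications.
pose F x : T + G := if x \in Z then inl (f x) else inr x.
exists (T + G)%type, F, [set c | if c is inl _ then true else false]; split.
- move=> x y; rewrite !inE /F; case: ifP => // xZ _; case: ifP => // yZ _ xy.
  have [x' [y' [x'Z y'Z ex ey a]]] := Zc _ _ xZ yZ xy.
  by exists x', y'; rewrite x'Z y'Z ex ey.
- move=> x y; rewrite !inE /F; case: ifP => // xZ _; case: ifP => // yZ _ _.
  by apply: Zi; rewrite !inE ?xZ ?yZ.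
- have -> : #|F @: G| = #|f @: Z| + #|~: Z|.
    rewrite -(card_imset (f @: Z) (@inl_inj T G)) -(card_imset (~: Z) (@inr_inj T G)).
    rewrite -cardsUI [X in _ + X]eq_card0 ?addn0; last first.
      by move=> c; rewrite !inE; apply/negP => /andP [/imsetP [a _ ->] /imsetP []].
    congr #|pred_of_set _|; apply/setP=> c; rewrite inE; apply/imsetP/orP.
      move=> [x _ ->]; rewrite /F; case: ifP => xZ; [left|right]; apply: imset_f.
        exact: imset_f.
      by rewrite inE xZ.
    case=> /imsetP [y yZ ->]; last by exists y; rewrite // /F; move: yZ; rewrite inE => /negbTE ->.
    by have /imsetP [x xZ ->] := yZ; exists x; rewrite // /F xZ.
  by have := cardsC Z; lia.
Qed.

(** * Vertices alone in their class, and the degree threshold *)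

Section Structure.
Variables (V : finType) (e : rel V).
Hypotheses (e_sym : symmetric e) (e_irr : irreflexive e).
Variables (tT : finType) (k : nat) (Z : {set V}) (f : V -> tT).
Hypothesis sol : solution e k Z f.

Definition singles : {set V} :=
  [set v in Z | [forall u in Z, (f u == f v) ==> (u == v)]].

Lemma singlesP v u : v \in singles -> u \in Z -> f u = f v -> u = v.
Proof.
by rewrite inE => /andP [_ /forall_inP H] /H /implyP h /eqP /h /eqP.
Qed.

Lemma singles_sub v : v \in singles -> v \in Z.
Proof. by rewrite inE => /andP []. Qed.

Lemma singles_adj v u : v \in singles -> u \in Z -> f u != f v ->
  exists u', [/\ u' \in Z, f u' = f u & e u' v].
Proof.
case: sol => _ Zc _ vS uZ uv; have vZ := singles_sub vS.
have [u' [v' [u'Z v'Z eu ev]]] := Zc _ _ uZ vZ uv.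
by rewrite (singlesP vS v'Z ev) => a; exists u'.
Qed.

Lemma singles_clique u v : u \in singles -> v \in singles -> u != v -> e u v.
Proof.
move=> uS vS uv; have uZ := singles_sub uS.
have [|u' [u'Z /(singlesP uS u'Z) -> //]] := singles_adj vS uZ.
by apply: contra uv => /eqP/(singlesP vS uZ) ->.
Qed.

(** After choosing one representative per class, at most [k] other vertices are left; a vertex that
    shares its class is one of these or the representative of one of these. *)
Lemma card_nonsingles : #|Z :\: singles| <= 2 * k.
Proof.
case: sol => _ _ Zk.
pose rep x := odflt x [pick y | (y \in Z) && (f y == f x)].
have repP x : x \in Z -> (rep x \in Z) /\ f (rep x) = f x.
  move=> xZ; rewrite /rep; case: pickP => [y /andP [yZ /eqP] //|/(_ x)].
  by rewrite xZ eqxx.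
have repE x y : x \in Z -> f x = f y -> rep x = rep y.
  move=> xZ E; rewrite /rep E; case: pickP => // /(_ x).
  by rewrite xZ E eqxx.
pose D := [set x in Z | rep x != x].
have cardD : #|D| <= k.
  suff: #|f @: Z| + #|D| <= #|Z| by lia.
  have -> : #|Z| = #|Z :\: D| + #|D|.
    by rewrite -(cardsID D Z) (setIidPr _) 1?addnC //; apply/subsetP=> x; rewrite inE => /andP [].
  rewrite leq_add2r; apply: leq_trans (leq_imset_card f _).
  apply/subset_leq_card/subsetP => c /imsetP [x xZ ->].
  have [rZ rE] := repP _ xZ; apply/imsetP; exists (rep x) => //.
  by rewrite !inE rZ andbT negbK; apply/eqP/repE.
apply: leq_trans (_ : #|D :|: rep @: D| <= _).
  apply/subset_leq_card/subsetP => x; rewrite !inE => /andP [].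
  move=> nx xZ; rewrite xZ /= in nx *.
  case/forall_inPn: nx => u uZ; rewrite negb_imply => /andP [/eqP fu ux].
  have [rx|rx] //= := eqVneq (rep x) x.
  apply/imsetP; exists u; rewrite ?inE ?uZ (repE _ _ uZ fu) rx //.
  by rewrite eq_sym.
have := cardsUI D (rep @: D); have /= := leq_imset_card rep D; lia.
Qed.

Definition degree v := #|[set u | e v u]|.

(* If neither degree threshold separated [singles] from [~: Z] up to 4k+2    *)
(* exceptions, the pairs of exceptions would be too many: each one on the    *)
(* clique side has few neighbors, each one on the independent side few       *)
(* nonneighbors across.                                                      *)
Lemma degree_threshold : exists2 th, th <= #|V| &
  #|[set v | (th <= degree v) && (v \notin singles)
           || (degree v < th) && (v \in Z)]| <= 6 * k + 2.
Proof.
case: sol => Zi _ _; pose h := #|singles|; pose S := Z :\: singles.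
have cS : #|S| <= 2 * k := card_nonsingles.
have degV v : degree v < #|V|.
  rewrite -cardsT; apply: proper_card; apply/properP; split; first exact: subsetT.
  by exists v; rewrite !inE ?e_irr.
have split3 v : v \in Z -> v \notin singles -> v \in S.
  by move=> vZ vs; rewrite /S in_setD vs vZ.
have degW v : v \notin Z -> degree v <= #|[set u in singles | e v u]| + 2 * k.
  move=> vZ; apply: leq_trans (_ : #|[set u in singles | e v u] :|: S| <= _).
    apply/subset_leq_card/subsetP => u; rewrite !inE => a.
    have [uZ|uZ] := boolP (u \in Z); last first.
      by have := Zi v u; rewrite !inE vZ uZ a => /(_ isT isT).
    by rewrite a !andbT /=; case: (forall_inP).
  by have := cardsUI [set u in singles | e v u] S; lia.
have degK v : v \in singles -> h + #|[set u in ~: Z | e v u]| <= (degree v).+1.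
  move=> vS; have -> : h = #|singles :\ v|.+1 by rewrite /h (cardsD1 v) vS.
  rewrite addSn ltnS -cardsUI [X in _ + X]eq_card0 ?addn0; last first.
    move=> u; rewrite !inE; apply/negP=> /andP [/andP [_ /andP [uZ _]]].
    by rewrite uZ.
  apply/subset_leq_card/subsetP => u.
  case/setUP=> [/setD1P [uv uS]|]; last by rewrite !inE => /andP [].
  by rewrite inE e_sym singles_clique.
have degWh v : v \notin Z -> degree v <= h + 2 * k.
  move=> /degW; have : #|[set u in singles | e v u]| <= h.
    by apply/subset_leq_card/subsetP => u; rewrite inE => /andP [].
  lia.
(* [A1] and [A2] collect the overlap of the two degree ranges: degrees are at most [h + 2 * k]
   outside [Z] and at least [h - 1] on [singles]. *)
pose A1 := [set v in singles | degree v <= h + 2 * k].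
pose A2 := [set v in ~: Z | h <= (degree v).+1].
have A12 : #|A1| * #|A2| <= (#|A1| + #|A2|) * (2 * k + 1).
  have -> : #|A1| * #|A2| = \sum_(x in A1) \sum_(y in A2) (e x y + ~~ e x y).
    rewrite -sum_nat_const; apply: eq_bigr => x _.
    by rewrite -sum1_card; apply: eq_bigr => y _; case: (e x y).
  under eq_bigr => x _ do rewrite big_split /=.
  rewrite big_split /= mulnDl; apply: leq_add.
    rewrite -sum_nat_const; apply: leq_sum => x; rewrite inE => /andP [xS dx].
    have dK := degK _ xS.
    suff: \sum_(y in A2) e x y <= #|[set u in ~: Z | e x u]| by lia.
    rewrite -sum1_card [X in _ <= X]big_mkcond [X in X <= _]big_mkcond /=.
    by apply: leq_sum => y _; rewrite !inE; case: (y \in Z) => //=; case: (h <= _); case: (e x y).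
  rewrite exchange_big /= -sum_nat_const; apply: leq_sum => y; rewrite !inE.
  move=> /andP [yZ hy]; have dW := degW _ yZ.
  have : #|[set u in singles | e y u]| + #|[set u in singles | ~~ e y u]| = h.
    rewrite /h -(cardsID [set u | e y u] singles); congr (_ + _).
      by apply: eq_card => u; rewrite !inE.
    by apply: eq_card => u; rewrite !inE andbC.
  suff: \sum_(x in A1) ~~ e x y <= #|[set u in singles | ~~ e y u]| by lia.
  rewrite -sum1_card [X in _ <= X]big_mkcond [X in X <= _]big_mkcond /=.
  apply: leq_sum => x _; rewrite !in_set [e y x]e_sym.
  by case: ifP => // /andP [-> _] /=; case: (e x y).
(* By [A12] the two sets cannot both exceed [2 * (2 * k + 1)]. If [A1] is small, a threshold above
   all degrees outside [Z] errs only on [S] and [A1]; capping it at [#|V|] is harmless, since every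
   degree is smaller than [#|V|]. *)
have [small1|big1] := leqP #|A1| (4 * k + 2).
  exists (minn #|V| (h + 2 * k).+1); first exact: geq_minl.
  apply: leq_trans (_ : #|S :|: A1| <= _).
    apply/subset_leq_card/subsetP => v; rewrite in_setU inE.
    have [vs|vs] := boolP (v \in singles).
      rewrite andbF /= => /andP [dv _]; rewrite [v \in A1]inE vs orbC.
      by move: dv; rewrite leq_min ltnS => /andP [_]; rewrite -ltnS => ->.
    have [vZ|vZ] := boolP (v \in Z); first by rewrite split3.
    rewrite andbT andbF orbF geq_min leqNgt degV /= => dv.
    by have := degWh _ vZ; lia.
  have := cardsUI S A1; lia.
have small2 : #|A2| <= 4 * k + 2 by move: A12 big1; clear; nia.
(* No vertex of [singles] has a smaller degree, so only [S] and [A2] are mispredicted. *)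
exists h.-1.
  by apply: leq_trans (leq_pred _) _; rewrite -cardsT; apply/subset_leq_card/subsetT.
apply: leq_trans (_ : #|S :|: A2| <= _); last by have := cardsUI S A2; lia.
apply/subset_leq_card/subsetP => v; rewrite in_setU inE.
have [vs|vs] := boolP (v \in singles).
  by rewrite andbF /= => /andP [dv _]; have := degK _ vs; lia.
have [vZ|vZ] := boolP (v \in Z); first by rewrite split3.
by rewrite andbT andbF orbF orbC !inE vZ /= => dv; rewrite (_ : h <= _) //; lia.
Qed.

End Structure.

(** * The algorithm *)

(** A loop that overwrites its result at every hit returns the last hit, hence this order of search.
    With default [n], a result below [n] signals success. *)
Fixpoint last_sat (P : pred nat) (d m : nat) : nat :=
  if m is m'.+1 then if P m' then m' else last_sat P d m' else d.

Variant last_sat_spec (P : pred nat) d m : nat -> Type :=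
| LastSat x of P x & x < m : last_sat_spec P d m x
| NoSat of (forall x, x < m -> ~~ P x) : last_sat_spec P d m d.

Lemma last_satP P d m : last_sat_spec P d m (last_sat P d m).
Proof.
elim: m => [|m IH] /=; first by right.
case: ifP => Pm; first by left.
case: IH => [x Px ltx|nP]; first by left; rewrite // ltnW.
by right=> x; rewrite ltnS leq_eqVlt => /orP [/eqP->|/nP //]; rewrite Pm.
Qed.

Definition ex_below (n : nat) (P : pred nat) : bool := last_sat P n n < n.

Lemma ex_belowP n (P : pred nat) : reflect (exists2 x, x < n & P x) (ex_below n P).
Proof.
rewrite /ex_below; case: last_satP => [x Px ltx|nP].
  by rewrite ltx; constructor; exists x.
by rewrite ltnn; constructor => [[x ltx]]; apply/negP/nP.
Qed.

Lemma ex_below_ord n (P : pred nat) : ex_below n P = [exists x : 'I_n, P x].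
Proof.
apply/ex_belowP/existsP => [[x ltx Px]|[x Px]]; last by exists x.
by exists (Ordinal ltx).
Qed.

Section Algorithm.
Variables (n k : nat) (a : nat -> nat -> bool).

Definition budget := 6 * k + 2.
Definition base := (2 * budget).+1.

(* A label is 0 on the independent side, 1 .. 2 * budget for a class to be   *)
(* identified, [base] if only membership in the clique side is known, and    *)
(* base.+1 + v if v is supposed to stay alone in its class.                  *)
Implicit Types lab : nat -> nat.

Definition init (th : nat) : nat -> nat :=
  fun v => if (v < n) && (th <= \sum_(u < n) a v u) then base.+1 + v else 0.

Definition conflict lab x y : bool :=
  [&& base < lab x, base < lab y, x != y & ~~ a x y]
  || [&& lab x == 0, lab y == 0 & a x y].

(* Every guess is a digit, in base [base], of the number [p.2].              *)
Definition repair (p : (nat -> nat) * nat) : (nat -> nat) * nat :=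
  let x := last_sat (fun x => ex_below n (conflict p.1 x)) n n in
  if x < n then
    let y := last_sat (conflict p.1 x) n n in
    (update p.1 (if p.2 %% base != 0 then x else y)
       (if p.2 %/ base %% base != 0 then base else 0), p.2 %/ base %/ base)
  else p.

(** [cond] sees the labels as already changed by the pass, because the program overwrites them in
    place. *)
Fixpoint relabel (cond : (nat -> nat) -> pred nat) (m : nat)
    (p : (nat -> nat) * nat) : (nat -> nat) * nat :=
  if m is m'.+1 then
    let q := relabel cond m' p in
    if cond q.1 m' then (update q.1 m' (q.2 %% base), q.2 %/ base) else q
  else p.

Definition class_adj lab u v : bool :=
  ex_below n (fun u' => ex_below n (fun v' =>
    [&& lab u' == lab u, lab v' == lab v & a u' v'])).

Definition unassigned lab v := lab v == base.

Definition lonely lab v :=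
  (base < lab v) && ex_below n (fun u =>
    [&& 0 < lab u, lab u <= budget & ~~ class_adj lab u v]).

(** The guesses [w = n] and [g = n] mean that there is no such vertex: they only touch a label
    outside the graph. *)
Definition labelling (th w g tau : nat) : nat -> nat :=
  let p1 := iter budget repair (init th, tau) in
  let p2 := iter budget repair (update p1.1 w 0, p1.2) in
  let p3 := relabel unassigned n p2 in
  (relabel lonely n (update p3.1 g (2 * budget), p3.2)).1.

Definition violation lab : bool :=
  ex_below n (fun u => ex_below n (fun v =>
    if lab u == 0 then (lab v == 0) && a u v
    else [&& lab v != 0, lab u != lab v & ~~ class_adj lab u v])).

(** Exactly one vertex of each class, the first, is not repeated; so the sum in [accepts] is the
    number of identifications. *)
Definition repeated lab v :=
  (lab v != 0) && ex_below n (fun u => (u < v) && (lab u == lab v)).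

Definition accepts lab : bool :=
  ~~ violation lab && (\sum_(v < n) repeated lab v <= k).

Variable e : rel 'I_n.
Hypothesis a_e : forall i j : 'I_n, a i j = e i j.

Definition clique_side lab : {set 'I_n} := [set v : 'I_n | lab v != 0].

Lemma class_adjP lab (u v : 'I_n) :
  reflect (exists u' v' : 'I_n, [/\ lab u' = lab u, lab v' = lab v & e u' v'])
          (class_adj lab u v).
Proof.
rewrite /class_adj ex_below_ord; apply: (iffP existsP) => [[u']|[u' [v' [h1 h2 h3]]]].
  rewrite ex_below_ord => /existsP [v' /and3P [/eqP h1 /eqP h2]].
  by rewrite a_e; exists u', v'.
exists u'; rewrite ex_below_ord; apply/existsP; exists v'.
by rewrite h1 h2 a_e h3 !eqxx.
Qed.

Lemma violationPn lab :
  reflect (independent e (~: clique_side lab) /\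
           clique_classes e (clique_side lab) (fun v : 'I_n => lab v))
          (~~ violation lab).
Proof.
rewrite /violation ex_below_ord negb_exists.
apply: (iffP forallP) => [H|[Ci Cc] u].
  have {}H (u v : 'I_n) : ~~ (if lab u == 0 then (lab v == 0) && a u v
    else [&& lab v != 0, lab u != lab v & ~~ class_adj lab u v]).
    by have := H u; rewrite ex_below_ord negb_exists => /forallP /(_ v).
  split=> u v; rewrite !inE.
    move=> /negPn u0 /negPn v0; have := H u v.
    by rewrite u0 v0 a_e.
  move=> /negbTE u0 v0 uv; have := H u v; rewrite u0 v0 uv /= negbK.
  case/class_adjP => u' [v' [h1 h2 h3]]; exists u', v'.
  by rewrite !inE h1 h2 u0 v0.
rewrite ex_below_ord negb_exists; apply/forallP => v.
case: ifPn => u0; rewrite !negb_and.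
  have [v0|//] := boolP (lab v == 0); rewrite a_e.
  by apply: Ci; rewrite !inE negbK.
have [v0|//] := boolP (lab v != 0); have [//|uv] := boolP (lab u == lab v).
rewrite /= negbK; apply/class_adjP.
have [||u' [v' [_ _ h1 h2 h3]]] := Cc u v _ _ uv; rewrite ?inE //.
by exists u', v'.
Qed.

(** Labels are arbitrary numbers, whereas the classes of a solution are named in a finite type; the
    least vertex of a class serves as its name. *)
Definition leader lab (x : 'I_n) : 'I_n := [arg min_(y < x | lab y == lab x) (y : nat)].

Lemma leaderP lab (x : 'I_n) : lab (leader lab x) = lab x /\
  forall y : 'I_n, lab y = lab x -> leader lab x <= y.
Proof.
rewrite /leader; case: arg_minnP => // y /eqP -> H; split=> // z /eqP; exact: H.
Qed.

Lemma leader_eq lab (x y : 'I_n) : lab x = lab y -> leader lab x = leader lab y.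
Proof.
move=> E; have [Ex Hx] := leaderP lab x; have [Ey Hy] := leaderP lab y.
by apply/val_inj/eqP; rewrite eqn_leq Hx ?Hy // ?Ex ?Ey.
Qed.

Lemma repeatedE lab (x : 'I_n) :
  repeated lab x = (x \in clique_side lab) && (leader lab x != x).
Proof.
rewrite /repeated inE; case: (lab x != 0) => //=.
have [E H] := leaderP lab x.
rewrite ex_below_ord; apply/existsP/idP => [[u /andP [ux /eqP ul]]|nx].
  by rewrite -val_eqE neq_ltn (leq_ltn_trans (H _ ul) ux).
exists (leader lab x); rewrite E eqxx andbT ltn_neqAle H // andbT.
by rewrite val_eqE.
Qed.

Lemma sum_repeated lab :
  \sum_(v < n) repeated lab v
  = #|[set x in clique_side lab | leader lab x != x]|.
Proof.
rewrite -sum1dep_card [RHS]big_mkcond /=; apply: eq_bigr => x _.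
by rewrite repeatedE /= inE; case: (_ && _).
Qed.

Lemma accepts_sound lab : accepts lab ->
  solution e k (clique_side lab) (leader lab).
Proof.
case/andP=> /violationPn [Ci Cc]; rewrite sum_repeated => cost; split=> //.
  move=> x y xZ yZ xy; have [|x' [y' [x'Z y'Z /leader_eq h1 /leader_eq h2 h3]]] := Cc x y xZ yZ.
    by apply: contra xy => /eqP /leader_eq ->.
  by exists x', y'.
set D := [set x in _ | _] in cost.
have DZ : D \subset clique_side lab by apply/subsetP=> x; rewrite inE => /andP [].
have : #|clique_side lab| = #|D| + #|clique_side lab :\: D|.
  by rewrite -(cardsID D) (setIidPr DZ).
move=> ->; apply: leq_add cost _; apply: subset_leq_card.
apply/subsetP=> x; rewrite in_setD => /andP [xD xZ]; apply/imsetP; exists x => //.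
by move: xD; rewrite inE xZ negbK => /eqP.
Qed.

(** [X] is a partial transversal: its pairwise distinct labels bound the number of classes from
    below. *)
Lemma accepts_complete lab (X : {set 'I_n}) :
  independent e (~: clique_side lab) ->
  clique_classes e (clique_side lab) (fun v : 'I_n => lab v) ->
  X \subset clique_side lab -> {in X &, injective (fun v : 'I_n => lab v)} ->
  #|clique_side lab| <= k + #|X| -> accepts lab.
Proof.
move=> Ci Cc XZ Xinj cost; apply/andP; split; first exact/violationPn.
rewrite sum_repeated; set D := [set x in _ | _].
have DZ : D \subset clique_side lab by apply/subsetP=> x; rewrite inE => /andP [].
have : #|clique_side lab| = #|D| + #|clique_side lab :\: D|.
  by rewrite -(cardsID D) (setIidPr DZ).
move=> E; suff le : #|X| <= #|clique_side lab :\: D|.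
  by rewrite -(leq_add2r #|clique_side lab :\: D|) -E (leq_trans cost) ?leq_add2l.
rewrite -(card_in_imset (f := leader lab)); last first.
  move=> x y xX yX lxy; apply: Xinj => //.
  by have [<- _] := leaderP lab x; have [<- _] := leaderP lab y; rewrite lxy.
apply/subset_leq_card/subsetP => z /imsetP [x xX ->].
have [lx _] := leaderP lab x; have := subsetP XZ _ xX.
by rewrite !inE lx => ->; rewrite (leader_eq lx) eqxx.
Qed.

End Algorithm.

(** * Normal form of solutions *)

Section NormalForm.
Variables (V : finType) (e : rel V).
Hypothesis e_sym : symmetric e.
Variables (tT : finType) (k : nat) (K M : {set V}) (f : V -> tT).
Hypothesis disjKM : forall v, v \in K -> v \notin M.
Hypothesis K_clique : forall u v, u \in K -> v \in K -> u != v -> e u v.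
Hypothesis sol : solution e k (K :|: M) f.

Definition meets_K (c : tT) : bool := [exists y in K, f y == c].

(** A class that does not meet [K] lies inside [M]. A vertex of [K] nonadjacent to all of such a
    class cannot be alone; any other vertex of [K] can, as far as these classes and [K] are
    concerned. *)
Definition bad : {set V} :=
  [set x in K | [exists m in M, ~~ meets_K (f m) &&
                   [forall u in M, (f u == f m) ==> ~~ e u x]]].

Definition meets_good (c : tT) : bool := [exists y in K :\: bad, f y == c].

Lemma meets_good_K c : meets_good c -> meets_K c.
Proof.
by case/exists_inP=> y /setDP [yK _] yc; apply/exists_inP; exists y.
Qed.

(** A vertex alone in its class is adjacent to every other class, so bad vertices share theirs and
    [card_nonsingles] applies. *)
Lemma card_bad : #|bad| <= 2 * k.
Proof.
apply: leq_trans (card_nonsingles sol).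
apply/subset_leq_card/subsetP => x; rewrite inE => /andP [xK].
case/exists_inP=> m mM /andP [nK /forall_inP H].
rewrite in_setD in_setU xK andbT; apply/negP => xS.
have fmx : f m != f x.
  by apply: contra nK => /eqP ->; apply/exists_inP; exists x.
have mZ : m \in K :|: M by rewrite inE mM orbT.
have [u [uZ fu eux]] := singles_adj sol xS mZ fmx.
have uM : u \in M.
  move: uZ; rewrite inE => /orP [uK|//]; case/negP: nK.
  by apply/exists_inP; exists u; rewrite ?fu.
by have := H _ uM; rewrite fu eqxx eux.
Qed.

Lemma good_adj x m : x \in K :\: bad -> m \in M -> ~~ meets_K (f m) ->
  exists u, [/\ u \in M, f u = f m & e u x].
Proof.
rewrite in_setD => /andP [xb xK] mM nK; move: xb; rewrite inE xK /=.
rewrite negb_exists_in => /forall_inP /(_ _ mM); rewrite nK /=.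
case/forall_inPn=> u uM; rewrite negb_imply negbK => /andP [/eqP fu eux].
by exists u.
Qed.

Variables (lim top : nat) (g : option V) (alone : V -> nat).
Hypotheses (limM : #|M| <= lim) (lim_top : lim + 2 * k < top).
Hypothesis alone_inj : injective alone.
Hypothesis alone_top : forall v, top < alone v.

(** Three disjoint ranges: [top] for all classes with a good vertex, which are merged; numbers
    between [lim] and [top] for classes meeting [K] in bad vertices only; [1 .. lim] for classes
    inside [M]. Zero is left to the independent side. *)
Definition class_label (v : V) : nat :=
  if meets_good (f v) then top
  else if meets_K (f v) then (lim + index (f v) (enum (f @: bad))).+1
  else (index (f v) (enum (f @: M))).+1.

Definition final (v : V) : nat :=
  if v \in M :|: bad then class_label v
  else if Some v == g then top
  else if v \in K then alone v else 0.

Lemma index_lt (A : {set V}) c (d : nat) : #|A| <= d -> c \in f @: A ->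
  index c (enum (f @: A)) < d.
Proof.
move=> cA cin; apply: leq_trans cA; apply: leq_trans (leq_imset_card f A).
by rewrite cardE index_mem mem_enum.
Qed.

Lemma meets_bad v : ~~ meets_good (f v) ->
  meets_K (f v) -> f v \in f @: bad.
Proof.
move=> ng /exists_inP [y yK /eqP E]; rewrite -E; apply: imset_f.
apply: contraR ng => yb; apply/exists_inP; exists y; last by rewrite E.
by rewrite inE yb.
Qed.

Lemma meetsN_M v : v \in M :|: bad -> ~~ meets_K (f v) -> v \in M.
Proof.
rewrite inE => /orP [//|]; rewrite inE => /andP [vK _] /negP[].
by apply/exists_inP; exists v.
Qed.

Lemma class_label_small v : v \in M :|: bad ->
  (class_label v <= lim) = ~~ meets_K (f v).
Proof.
move=> vMb; rewrite /class_label.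
case: ifPn => [/meets_good_K ->|ng]; first lia.
case: ifPn => [_|nK]; first lia.
by apply: (index_lt limM); apply: imset_f; apply: meetsN_M.
Qed.

Lemma class_label_le v : v \in M :|: bad -> 0 < class_label v <= top.
Proof.
move=> vMb; rewrite /class_label.
case: ifPn => [_|ng]; first lia.
case: ifPn => [mK|nK].
  have := index_lt card_bad (meets_bad ng mK); lia.
have := index_lt limM (imset_f f (meetsN_M vMb nK)); lia.
Qed.

Lemma class_label_eq_top v : v \in M :|: bad ->
  (class_label v == top) = meets_good (f v).
Proof.
move=> vMb; rewrite /class_label.
case: ifPn => [_|ng]; first by rewrite eqxx.
case: ifPn => [mK|nK]; apply/negbTE.
  have := index_lt card_bad (meets_bad ng mK); lia.
have := index_lt limM (imset_f f (meetsN_M vMb nK)); lia.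
Qed.

Lemma class_label_inj u v : u \in M :|: bad -> v \in M :|: bad ->
  ~~ meets_good (f u) -> class_label u = class_label v -> f u = f v.
Proof.
move=> uMb vMb ng E.
have ngv : ~~ meets_good (f v).
  by rewrite -class_label_eq_top // -E class_label_eq_top.
have := E; have := congr1 (fun c => c <= lim) E.
rewrite /= !class_label_small // /class_label (negbTE ng) (negbTE ngv) => /negb_inj mE.
rewrite -mE; case: ifPn => mK.
  move=> [] /addnI iE; rewrite mE in mK.
  have uin : f u \in enum (f @: bad) by rewrite mem_enum meets_bad // mE.
  have vin : f v \in enum (f @: bad) by rewrite mem_enum meets_bad.
  by rewrite -(nth_index (f u) uin) iE nth_index.
move=> [] iE; have nv : ~~ meets_K (f v) by rewrite -mE.
have uin : f u \in enum (f @: M) by rewrite mem_enum imset_f // meetsN_M.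
have vin : f v \in enum (f @: M) by rewrite mem_enum imset_f // meetsN_M.
by rewrite -(nth_index (f u) uin) iE nth_index.
Qed.

Lemma class_label_f u v : f u = f v -> class_label u = class_label v.
Proof. by rewrite /class_label => ->. Qed.

Hypothesis gP : if g is Some y then y \in K :\: bad else K \subset bad.

Lemma final_neq0 v : (final v != 0) = (v \in K :|: M).
Proof.
rewrite /final; case: ifPn => vMb.
  have -> : v \in K :|: M.
    move: vMb; rewrite !inE => /orP [->|/andP [->]]; by rewrite ?orbT.
  by have := class_label_le vMb; lia.
have vM : v \notin M by apply: contra vMb; rewrite inE => ->.
rewrite [RHS]inE (negbTE vM) orbF.
case: (Some v =P g) => [gv|_].
  by move: gP; rewrite -gv in_setD => /andP [_ ->]; lia.
by case: ifP => // _; have := alone_top v; lia.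
Qed.

Lemma final_good v : v \in K :\: bad -> top <= final v.
Proof.
rewrite in_setD => /andP [vb vK]; rewrite /final in_setU (negbTE vb) orbF.
rewrite (negbTE (disjKM vK)) vK; case: ifP => // _.
exact/ltnW.
Qed.

Lemma final_good_inj u v : u \in K :\: bad -> v \in K :\: bad ->
  final u = final v -> u = v.
Proof.
rewrite !in_setD => /andP [ub uK] /andP [vb vK].
rewrite /final !in_setU (negbTE ub) (negbTE vb) !orbF.
rewrite (negbTE (disjKM uK)) (negbTE (disjKM vK)) uK vK.
case: (Some u =P g) => [gu|_]; case: (Some v =P g) => [gv|_].
- by move: gv; rewrite -gu => -[].
- by have := alone_top v; lia.
- by have := alone_top u; lia.
- exact: alone_inj.
Qed.

Lemma final_Mb v : v \in M :|: bad -> final v = class_label v.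
Proof. by rewrite /final => ->. Qed.

Lemma Z_cases v : v \in K :|: M -> (v \in M :|: bad) || (v \in K :\: bad).
Proof.
rewrite in_setU [v \in M :|: _]in_setU in_setD.
by case: (v \in K); case: (v \in M); case: (v \in bad).
Qed.

(** The dichotomy behind [final_clique_classes]. A new class either has a vertex of [K], which joins
    it to all others of this kind, and is adjacent to each class inside [M]; or it is an old class
    inside [M]. In the first case the adjacency to [M] comes from a good vertex if the class has
    one, and otherwise from [sol], since the class is then an old one. *)
Lemma final_class v : v \in K :|: M ->
  (exists y, [/\ y \in K, final y = final v &
      forall m, m \in M -> ~~ meets_K (f m) ->
        exists u y', [/\ u \in M, f u = f m, final y' = final v & e u y']])
  \/ (v \in M /\ ~~ meets_K (f v)).
Proof.
move=> vZ; case/orP: (Z_cases vZ) => [vMb|vg]; last first.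
  left; exists v; split=> //; first by case/setDP: vg.
  by move=> m mM nK; have [u [uM fu a]] := good_adj vg mM nK; exists u, v.
have [mK|nK] := boolP (meets_K (f v)); last by right; rewrite (meetsN_M vMb).
left; have [mg|ng] := boolP (meets_good (f v)).
  have fv : final v = top.
    by rewrite final_Mb //; apply/eqP; rewrite class_label_eq_top.
  have := gP; case Eg: g => [y|] => [yg|/subsetP Kb]; last first.
    by case/exists_inP: mg => y /setDP [/Kb ->].
  have [yK yb] := setDP yg.
  have fy : final y = top.
    rewrite /final in_setU (negbTE yb) orbF (negbTE (disjKM yK)).
    by rewrite Eg eqxx.
  exists y; rewrite fv fy; split=> // m mM nK.
  by have [u [uM fu a]] := good_adj yg mM nK; exists u, y.
have inMb x : x \in K :|: M -> f x = f v -> x \in M :|: bad.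
  move=> /Z_cases /orP [//|xg] fx; case/negP: ng; apply/exists_inP.
  by exists x; rewrite ?fx.
have [y yK /eqP fy] := exists_inP mK.
have yMb : y \in M :|: bad by apply: inMb; rewrite // inE yK.
exists y; split=> //; first by rewrite !final_Mb //; apply: class_label_f.
move=> m mM nK; case: sol => _ Zc _.
have mZ : m \in K :|: M by rewrite inE mM orbT.
have [|u [y' [uZ y'Z fu fy' a]]] := Zc m v mZ vZ.
  by apply: contra nK => /eqP ->.
exists u, y'; split=> //.
  by apply: contraR nK => uM; apply/exists_inP; exists u;
    rewrite ?fu //; move: uZ; rewrite inE (negbTE uM) orbF.
by rewrite !final_Mb ?inMb //; apply: class_label_f.
Qed.

Lemma final_M_f u v : u \in M -> v \in M -> f u = f v -> final u = final v.
Proof.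
by move=> uM vM fuv; rewrite !final_Mb ?inE ?uM ?vM //; apply: class_label_f.
Qed.

Lemma final_clique_classes : clique_classes e (K :|: M) final.
Proof.
have nz x y : y \in K :|: M -> final x = final y -> x \in K :|: M.
  by rewrite -!final_neq0 => y0 ->.
move=> x y xZ yZ xy.
case: (final_class xZ) => [[x1 [x1K ex hx]]|[xM nx]];
  case: (final_class yZ) => [[y1 [y1K ey hy]]|[yM ny]].
- exists x1, y1; split=> //; [exact: nz ex|exact: nz ey|].
  by apply: K_clique => //; apply: contra xy => /eqP E; rewrite -ex -ey E.
- have [u [x' [uM fu ex' a]]] := hx _ yM ny; exists x', u.
  rewrite e_sym; split=> //; [exact: nz ex'|by rewrite inE uM orbT|].
  exact: final_M_f.
- have [u [y' [uM fu ey' a]]] := hy _ xM nx; exists u, y'.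
  split=> //; [by rewrite inE uM orbT|exact: nz ey'|].
  exact: final_M_f.
- have fxy : f x != f y.
    by apply: contra xy => /eqP /(final_M_f xM yM) ->.
  case: sol => _ Zc _; have [x' [y' [x'Z y'Z ex ey a]]] := Zc _ _ xZ yZ fxy.
  have inM z z' : z' \in K :|: M -> f z' = f z -> ~~ meets_K (f z) -> z' \in M.
    move=> z'Z ez nK; apply: contraR nK => z'M; apply/exists_inP.
    by exists z'; rewrite ?ez //; move: z'Z; rewrite inE (negbTE z'M) orbF.
  have x'M := inM _ _ x'Z ex nx; have y'M := inM _ _ y'Z ey ny.
  by exists x', y'; split=> //; apply: final_M_f.
Qed.

(** The number of classes does not drop: an old class with a good vertex is represented by such a
    vertex, and good vertices have pairwise distinct labels from [top] on; the other old classes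
    keep distinct labels below [top]. *)
Lemma final_transversal : exists X : {set V},
  [/\ X \subset K :|: M, {in X &, injective final}
    & #|K :|: M| <= k + #|X|].
Proof.
pose rep v := if [pick y in K :\: bad | f y == f v] is Some y then y
              else odflt v [pick y in K :|: M | f y == f v].
have repP v : v \in K :|: M ->
    [/\ rep v \in K :|: M, f (rep v) = f v & meets_good (f v) -> rep v \in K :\: bad].
  move=> vZ; rewrite /rep; case: pickP => [y /andP [yg /eqP fy]|ng] /=.
    by have [yK _] := setDP yg; split=> //; rewrite inE yK.
  have nm : meets_good (f v) -> False.
    by case/exists_inP=> y yg fy; have := ng y; rewrite yg fy.
  case: pickP => [y /andP [yZ /eqP fy]|/(_ v)]; first by split=> // /nm.
  by rewrite vZ eqxx.
have repE u v : v \in K :|: M -> f u = f v -> rep u = rep v.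
  move=> vZ E; rewrite /rep E; case: pickP => //= _; case: pickP => // /(_ v).
  by rewrite vZ eqxx.
exists (rep @: (K :|: M)); split.
- by apply/subsetP=> x /imsetP [v vZ ->]; case: (repP v vZ).
- move=> _ _ /imsetP [u uZ ->] /imsetP [v vZ ->].
  have [ruZ ru gu] := repP _ uZ; have [rvZ rv gv] := repP _ vZ.
  have ngMb x : x \in K :|: M -> ~~ meets_good (f x) -> x \in M :|: bad.
    move=> /Z_cases /orP [//|xg] /negP[]; apply/exists_inP; by exists x.
  have [mu|nu] := boolP (meets_good (f u)); have [mv|nv] := boolP (meets_good (f v)).
  + exact: final_good_inj (gu mu) (gv mv).
  + have := final_good (gu mu); rewrite -rv in nv; have h := ngMb _ rvZ nv.
    have := class_label_le h; have := class_label_eq_top h.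
    by rewrite (final_Mb h) (negbTE nv); lia.
  + have := final_good (gv mv); rewrite -ru in nu; have h := ngMb _ ruZ nu.
    have := class_label_le h; have := class_label_eq_top h.
    by rewrite (final_Mb h) (negbTE nu); lia.
  + rewrite -ru in nu; rewrite -rv in nv.
    have hu := ngMb _ ruZ nu; have hv := ngMb _ rvZ nv.
    rewrite (final_Mb hu) (final_Mb hv) => /(class_label_inj hu hv nu).
    by rewrite ru rv; apply: repE.
- case: sol => _ _ cost; apply: leq_trans cost _; rewrite leq_add2l.
  apply: leq_trans (leq_imset_card f _).
  apply/subset_leq_card/subsetP => c /imsetP [v vZ ->].
  have [rvZ rv _] := repP _ vZ; apply/imsetP.
  by exists (rep v); [apply: imset_f|].
Qed.

End NormalForm.

(** * Some guess is accepted *)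

Section Completeness.
Variables (n k : nat) (a : nat -> nat -> bool) (e : rel 'I_n).
Hypotheses (e_sym : symmetric e) (e_irr : irreflexive e).
Hypothesis a_e : forall i j : 'I_n, a i j = e i j.

Local Notation budget := (budget k).
Local Notation base := (base k).
Local Notation conflict := (conflict k a).
Local Notation repair := (repair n k a).
Implicit Types lab : nat -> nat.

Definition conflict_free lab := forall x y : 'I_n, ~~ conflict lab x y.

Lemma repair_spec lab :
  conflict_free lab /\ (forall tau, repair (lab, tau) = (lab, tau)) \/
  exists x y : 'I_n, conflict lab x y /\ forall tau,
    repair (lab, tau) =
      (update lab (if tau %% base != 0 then x else y)
         (if tau %/ base %% base != 0 then base else 0), tau %/ base %/ base).
Proof.
rewrite /repair /=; case: last_satP => [x /ex_belowP [y0 lty0 cy0] ltx|nc].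
  right; rewrite ltx; case: last_satP => [y cy lty|nc]; last first.
    by have := nc _ lty0; rewrite cy0.
  by exists (Ordinal ltx), (Ordinal lty); split=> // tau; case: (tau %% base == 0).
left; rewrite ltnn; split=> // x y; have := nc x (ltn_ord x).
by apply: contra => c; apply/ex_belowP; exists y.
Qed.

Lemma digit_mod d t : d < base -> (t * base + d) %% base = d.
Proof. by move=> lt; rewrite modnMDl modn_small. Qed.

Lemma digit_div d t : d < base -> (t * base + d) %/ base = t.
Proof. by move=> lt; rewrite divnMDl ?divn_small ?addn0. Qed.

Lemma digit_lt d t : d < base -> t * base + d < base * t.+1.
Proof. by move=> lt; rewrite mulnS mulnC addnC ltn_add2r. Qed.

(** The tape is built backwards: [t'], what later stages read, is given, and the present digits
    become its low-order end. The bound in terms of [t'.+1] makes the powers of [base] multiply from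
    stage to stage. [mark] foretells the answer of [cond] on the half-changed labels [mix v]. *)
Lemma relabelP (cond : (nat -> nat) -> pred nat) (mark : pred nat)
    (d lab : nat -> nat) (m : nat) :
  let mix i := fun v => if (v < i) && mark v then d v else lab v in
  (forall v, v < m -> cond (mix v) v = mark v) ->
  (forall v, v < m -> mark v -> d v < base) ->
  forall t', exists2 t, t < base ^ (\sum_(v < m) mark v) * t'.+1 &
    relabel k cond m (lab, t) = (mix m, t').
Proof.
move=> mix; elim: m => [|m IH] Hc Hd t'.
  exists t'; first by rewrite big_ord0 expn0 mul1n.
  by rewrite /=; congr pair; apply: functional_extensionality => v.
have {}IH := IH (fun v lt => Hc v (ltnW lt)) (fun v lt => Hd v (ltnW lt)).
have [mm|nm] := boolP (mark m).
  have dm := Hd m (leqnn _) mm.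
  have [t lt E] := IH (t' * base + d m); exists t; last first.
    rewrite /= E /= Hc // mm digit_mod // digit_div //; congr pair.
    apply: functional_extensionality => v; rewrite /update /mix ltnS.
    by case: (ltngtP v m) => //= ->; rewrite mm.
  apply: leq_trans lt _; rewrite big_ord_recr /= mm addn1 expnSr -mulnA leq_mul2l.
  by rewrite digit_lt ?orbT.
have [t lt E] := IH t'; exists t; last first.
  rewrite /= E /= Hc // (negbTE nm); congr pair.
  apply: functional_extensionality => v; rewrite /mix ltnS.
  by case: (ltngtP v m) => //= ->; rewrite (negbTE nm).
by rewrite big_ord_recr /= (negbTE nm) addn0.
Qed.

Variables (tT : finType) (Z : {set 'I_n}) (f : 'I_n -> tT).
Hypothesis sol : solution e k Z f.

Definition lone lab : {set 'I_n} := [set v : 'I_n | base < lab v].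
Definition pending lab : {set 'I_n} := [set v : 'I_n | lab v == base].
Definition wrong lab : {set 'I_n} :=
  [set v : 'I_n | (base < lab v) && (v \notin singles Z f)
                  || (lab v == 0) && (v \in Z)].

(** A correction turns one wrong vertex into at most one pending vertex, so the last sum never
    grows; it bounds both the repairs still needed and the vertices whose class must be guessed. *)
Definition coherent lab : Prop :=
  [/\ forall v : 'I_n, [|| lab v == 0, lab v == base | lab v == base.+1 + v],
      pending lab \subset Z & #|pending lab| + #|wrong lab| <= budget].

Lemma update_ord lab (v u : 'I_n) c :
  update lab v c u = if u == v then c else lab u.
Proof. by []. Qed.

Lemma correct_wrong lab v : coherent lab -> v \in wrong lab ->
  let lab' := update lab v (if v \in Z then base else 0) in
  [/\ coherent lab', #|wrong lab'| < #|wrong lab| & lone lab' \subset lone lab].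
Proof.
move=> [three pZ bound] vw; set lab' := update _ _ _ => /=.
have E (u : 'I_n) : lab' u = if u == v then if v \in Z then base else 0 else lab u.
  exact: update_ord.
have b0 : (base == 0) = false by [].
have wE : wrong lab' = wrong lab :\ v.
  apply/setP=> u; rewrite in_setD1 !inE E; case: (u =P v) => //= ->.
  by case: ifP => vZ; rewrite ?ltnn ?b0 ?ltn0 ?andbF.
have cw := cardsD1 v (wrong lab); rewrite vw -wE in cw.
have cp : #|pending lab'| <= (#|pending lab|).+1.
  apply: leq_trans (_ : #|v |: pending lab| <= _); last first.
    by rewrite cardsU1; case: (v \notin _) => /=; lia.
  apply/subset_leq_card/subsetP => u; rewrite !inE E; by case: (u =P v).
split; [split| by rewrite cw |].
- move=> u; rewrite E; case: (u =P v) => _ //; case: ifP => _; by rewrite eqxx ?orbT.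
- apply/subsetP => u; rewrite inE E; case: (u =P v) => [->|_ pu].
    by case: ifP.
  by apply: (subsetP pZ); rewrite inE.
- by rewrite cw in bound; lia.
- apply/subsetP => u; rewrite !inE E; case: (u =P v) => // _.
  by case: ifP => _; rewrite ?ltnn ?ltn0.
Qed.

(** Correct predictions never conflict, as [singles] is a clique and [~: Z] is independent. *)
Lemma conflict_wrong lab (x y : 'I_n) : conflict lab x y ->
  x \in wrong lab \/ y \in wrong lab.
Proof.
case: (sol) => Zi _ _; rewrite /conflict a_e => /orP [/and4P [Kx Ky xy nxy]|/and3P [Ix Iy xy]].
  have [xs|xs] := boolP (x \in singles Z f); last by left; rewrite inE Kx xs.
  have [ys|ys] := boolP (y \in singles Z f); last by right; rewrite inE Ky ys.
  by rewrite (singles_clique sol xs ys) in nxy.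
have [xZ|xZ] := boolP (x \in Z); first by left; rewrite inE Ix xZ orbT.
have [yZ|yZ] := boolP (y \in Z); first by right; rewrite inE Iy yZ orbT.
by have := Zi x y; rewrite !inE xZ yZ xy => /(_ isT isT).
Qed.

(** The solution dictates two digits per repair, and each such repair removes a wrong vertex. If the
    conflicts end earlier, possibly with wrong vertices left, the remaining rounds change neither
    labels nor tape. *)
Lemma repair_complete m lab : coherent lab -> #|wrong lab| <= m ->
  exists lab', [/\ coherent lab', conflict_free lab', lone lab' \subset lone lab &
    forall t', exists2 t, t < base ^ (2 * m) * t'.+1 &
      iter m repair (lab, t) = (lab', t')].
Proof.
elim: m lab => [|m IH] lab co lew.
  exists lab; split=> //; last by move=> t'; exists t'; rewrite // muln0 expn0 mul1n.
  move=> x y; apply/negP => /conflict_wrong.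
  by move: lew; rewrite leqn0 cards_eq0 => /eqP ->; rewrite !inE => -[].
have [[cf id]|[x [y [c step]]]] := repair_spec lab.
  exists lab; split=> // t'; exists t'; last first.
    by elim: (m.+1) => //= q ->; rewrite id.
  by rewrite -[X in X <= _]mul1n leq_mul // expn_gt0.
have [v [vxy vw]] : exists v : 'I_n, (v = x \/ v = y) /\ v \in wrong lab.
  by case: (conflict_wrong c); [exists x|exists y]; split=> //; [left|right].
have [co' lt' sub'] := correct_wrong co vw.
have [|lab' [co2 cf2 sub2 tape]] := IH _ co'.
  by rewrite -ltnS; apply: leq_trans lt' lew.
exists lab'; split=> //; first exact: subset_trans sub2 sub'.
move=> t'; have [t lt E] := tape t'.
pose d1 : nat := v == x; pose d2 : nat := v \in Z.
have b2 : 1 < base by rewrite /base /budget; lia.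
have d1b : d1 < base by apply: leq_ltn_trans (leq_b1 _) b2.
have d2b : d2 < base by apply: leq_ltn_trans (leq_b1 _) b2.
exists ((t * base + d2) * base + d1).
  have -> : 2 * m.+1 = (2 * m).+2 by lia.
  rewrite !expnS -!mulnA; apply: leq_trans (_ : base * (base * t.+1) <= _).
    apply: leq_trans (digit_lt _ d1b) _.
    by rewrite leq_mul2l digit_lt ?orbT.
  by rewrite !leq_mul2l lt !orbT.
rewrite iterSr step digit_mod // digit_div // digit_mod // digit_div //.
have -> : (if d1 != 0 then x else y) = v.
  by rewrite /d1 eqb0 negbK; case: (v =P x) => [->|vx] //; case: vxy.
by rewrite -E /d2; congr (iter _ _ (update _ _ _, _)); case: (v \in Z).
Qed.

Lemma eq_lone lab lab' : (forall v : 'I_n, lab' v = lab v) ->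
  lone lab' = lone lab.
Proof. by move=> E; apply/setP=> v; rewrite !inE E. Qed.

Lemma eq_coherent lab lab' : (forall v : 'I_n, lab' v = lab v) ->
  coherent lab -> coherent lab'.
Proof.
move=> E [three pZ bound].
have Ep : pending lab' = pending lab by apply/setP=> v; rewrite !inE E.
have Ew : wrong lab' = wrong lab by apply/setP=> v; rewrite !inE E.
by split; rewrite ?Ep ?Ew // => v; rewrite E.
Qed.

Lemma init_coherent : exists2 th, th <= n & coherent (init n k a th).
Proof.
have [th leth bound] := degree_threshold e_sym e_irr sol.
exists th; first by rewrite card_ord in leth.
have E (v : 'I_n) :
    init n k a th v = if th <= degree e v then base.+1 + v else 0.
  rewrite /init ltn_ord; congr (if _ <= _ then _ else _).
  rewrite /degree -sum1dep_card [RHS]big_mkcond /=; apply: eq_bigr => u _.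
  by rewrite a_e; case: (e v u).
have p0 : pending (init n k a th) = set0.
  by apply/setP=> v; rewrite !inE E; case: ifP => _ //; apply/eqP; lia.
split.
- by move=> v; rewrite E; case: ifP => _; rewrite eqxx ?orbT.
- by rewrite p0 sub0set.
- rewrite p0 cards0 add0n; apply: leq_trans bound.
  apply/subset_leq_card/subsetP => v; rewrite !inE E.
  case: (leqP th (degree e v)) => _ /=; last by rewrite ?andbF.
  by rewrite orbF => /andP [_ ->].
Qed.

(** Two lone vertices outside [Z] would be adjacent for lack of conflicts, yet nonadjacent since
    [~: Z] is independent. The value [w = n] covers the case that there is none. *)
Lemma remove_outsider lab : coherent lab -> conflict_free lab ->
  exists2 w, w <= n & coherent (update lab w 0) /\ lone (update lab w 0) \subset Z.
Proof.
move=> co cf; have [L0|[w]] := set_0Vmem (lone lab :\: Z).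
  have E (v : 'I_n) : update lab n 0 v = lab v.
    by rewrite /update ltn_eqF // ltn_ord.
  exists n => //; split; first exact: eq_coherent co.
  by rewrite (eq_lone E) -setD_eq0 L0.
rewrite in_setD => /andP [wZ wl]; exists w; first exact/ltnW/ltn_ord.
have ww : w \in wrong lab.
  move: wl; rewrite inE => bl; rewrite inE bl /=; apply/orP; left.
  by apply: contra wZ; exact: singles_sub.
have := correct_wrong co ww; rewrite /= (negbTE wZ) => -[co' _ sub]; split=> //.
apply/subsetP => v vl; apply: contraLR isT => vZ.
have vl' := subsetP sub _ vl.
have vw : v != w.
  by apply/eqP => E; move: vl; rewrite E inE update_ord eqxx ltn0.
have := cf v w; rewrite /conflict; move: wl vl'; rewrite !inE => -> -> /=.
rewrite -val_eqE /= in vw; rewrite vw /= a_e.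
case: sol => Zi _ _; have := Zi v w; rewrite !inE vZ wZ => /(_ isT isT) ->.
by [].
Qed.

End Completeness.

(** * Guessing the classes of the remaining vertices *)

Section Completeness.
Variables (n k : nat) (a : nat -> nat -> bool) (e : rel 'I_n).
Hypotheses (e_sym : symmetric e) (e_irr : irreflexive e).
Hypothesis a_e : forall i j : 'I_n, a i j = e i j.

Local Notation budget := (budget k).
Local Notation base := (base k).

Section Relabelling.
Variables (lab : nat -> nat) (tT : finType) (f : 'I_n -> tT).
Let K := lone n k lab.
Let M := pending n k lab.
Hypothesis three :
  forall v : 'I_n, [|| lab v == 0, lab v == base | lab v == base.+1 + v].
Hypothesis K_clique : forall u v, u \in K -> v \in K -> u != v -> e u v.
Hypothesis sol : solution e k (K :|: M) f.
Hypothesis cardM : #|M| <= budget.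

Let top := 2 * budget.
Let alone (v : 'I_n) := base.+1 + v.
Let bd := bad e K M f.

Lemma three_K (v : 'I_n) : v \in K -> lab v = alone v.
Proof.
by rewrite inE; case/or3P: (three v) => /eqP -> //; rewrite ltnn.
Qed.

Lemma three_0 (v : 'I_n) : v \notin K -> v \notin M -> lab v = 0.
Proof.
rewrite !inE; case/or3P: (three v) => /eqP -> //; first by rewrite eqxx.
by rewrite ltnS leq_addr.
Qed.

Lemma disj_KM v : v \in K -> v \notin M.
Proof. by rewrite !inE => h; rewrite gtn_eqF. Qed.

Lemma budget_top : budget + 2 * k < top.
Proof. rewrite /top /budget; lia. Qed.

Lemma alone_inj : injective alone.
Proof. by move=> u v /addnI /val_inj. Qed.

Lemma alone_top v : top < alone v.
Proof. rewrite /alone /top /base; lia. Qed.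

Let g := [pick y in K :\: bd].
Let gn : nat := if g is Some y then y else n.

Lemma g_good : if g is Some y then y \in K :\: bd else K \subset bd.
Proof.
rewrite /g; case: pickP => // H; rewrite -setD_eq0; apply/eqP/setP=> v.
by rewrite in_set0; exact: H.
Qed.

Lemma gnE (v : 'I_n) : ((v : nat) == gn) = (Some v == g).
Proof. by rewrite /gn; case: g => [y|]; [|rewrite ltn_eqF]. Qed.

Let lbl := class_label e K M f budget top.

Definition on_ord (T : Type) (x0 : T) (h : 'I_n -> T) (v : nat) : T :=
  if insub v is Some i then h i else x0.

Lemma on_ordE T x0 (h : 'I_n -> T) (v : 'I_n) : on_ord x0 h v = h v.
Proof. by rewrite /on_ord valK. Qed.

(** [lab4] is the labelling between the two passes, [mix i] the one (with [g] relabelled) when the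
    second pass reaches vertex [i]. *)
Let lab4 v := if (v < n) && unassigned k lab v then on_ord 0 lbl v else lab v.
Let mark := on_ord false (fun v => v \in bd).
Let mix i v := if (v < i) && mark v then on_ord 0 lbl v else update lab4 gn top v.

Lemma mixE i (v : 'I_n) : mix i v =
  if (v < i) && (v \in bd) then lbl v else if Some v == g then top
  else if v \in M then lbl v else lab v.
Proof.
have -> : (v \in M) = unassigned k lab v by rewrite inE.
by rewrite /mix /mark !on_ordE /update gnE /lab4 ltn_ord /= on_ordE.
Qed.

Lemma M_Mb v : v \in M -> v \in M :|: bd.
Proof. by move=> vM; rewrite in_setU vM. Qed.

Lemma bad_Mb v : v \in bd -> v \in M :|: bd.
Proof. by move=> vb; rewrite in_setU vb orbT. Qed.

Lemma bad_K v : v \in bd -> v \in K.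
Proof. by rewrite inE => /andP []. Qed.

(** The second pass gives labels above [budget] to its vertices, all of which lie in [K]. So at each
    of its moments the small labels mark exactly the classes inside [M], and the test [lonely] does
    not depend on the progress made. *)
Lemma mix_small i (u : 'I_n) : (0 < mix i u) && (mix i u <= budget) =
  (u \in M) && ~~ meets_K K f (f u).
Proof.
have small := class_label_small cardM budget_top.
have le := class_label_le sol cardM budget_top.
have bt := budget_top.
rewrite mixE; case: ifP => [/andP [_ ub]|_].
  rewrite (negbTE (disj_KM (bad_K ub))) /lbl small ?bad_Mb //= andbC.
  rewrite (_ : meets_K _ _ _) //; apply/exists_inP; exists u => //.
  exact: bad_K.
case: (Some u =P g) => [gu|_].
  have := g_good; rewrite -gu => /setDP [uK _].
  by rewrite (negbTE (disj_KM uK)) /=; lia.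
case: ifPn => uM.
  by rewrite /lbl small ?M_Mb //; case/andP: (le _ (M_Mb uM)) => ->.
have [uK|uK] := boolP (u \in K); last by rewrite three_0.
by rewrite (three_K uK) /alone /base; lia.
Qed.

Lemma mix_alone i (u : 'I_n) : base < mix i u -> u \in K /\ mix i u = alone u.
Proof.
have le := class_label_le sol cardM budget_top.
have lb v : v \in M :|: bd -> base < lbl v -> False.
  by move=> /le /andP [_ h1] h2; move: h1 h2; rewrite /lbl /top /base; lia.
rewrite mixE; case: ifP => [/andP [_ ub] /(lb _ (bad_Mb ub)) //|_].
case: ifP => _; first by rewrite /base /top; lia.
case: ifPn => [uM /(lb _ (M_Mb uM)) //|uM bl].
have uK : u \in K by rewrite inE.
by rewrite (three_K uK).
Qed.

Lemma lonely_mix (v : 'I_n) : lonely n k a (mix v) v = (v \in bd).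
Proof.
have inj := class_label_inj sol cardM budget_top.
rewrite /lonely ex_below_ord.
have [bl|nbl] := boolP (base < mix v v); last first.
  apply/esym/negbTE; apply: contra nbl => vb; have vK := bad_K vb.
  rewrite mixE ltnn /=; case: (Some v =P g) => [gv|_].
    by have := g_good; rewrite -gv => /setDP [_]; rewrite vb.
  by rewrite (negbTE (disj_KM vK)) (three_K vK) /alone; lia.
have [vK mv] := mix_alone bl.
have mixM u : u \in M -> mix v u = lbl u.
  move=> uM; rewrite mixE (_ : _ && _ = false).
    rewrite uM; case: (Some u =P g) => // gu.
    by have := g_good; rewrite -gu => /setDP [/disj_KM]; rewrite uM.
  by apply/negP => /andP [_ /bad_K /disj_KM]; rewrite uM.
rewrite /= [RHS]inE vK /=; apply/existsP/exists_inP => [[u]|[u uM /andP [nK /forall_inP H]]].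
  rewrite andbA mix_small => /andP [/andP [uM nK] nadj].
  exists u => //; rewrite nK /=; apply/forall_inP => u' u'M; apply/implyP => /eqP fu.
  apply: contra nadj => a'; apply/(class_adjP a_e); exists u', v; split=> //.
  by rewrite !mixM //; apply: class_label_f.
exists u; rewrite andbA mix_small uM nK /=; apply/(class_adjP a_e) => -[u' [v' [eu ev a']]].
have /andP [u'M nK'] : (u' \in M) && ~~ meets_K K f (f u').
  by rewrite -(mix_small v) eu mix_small uM.
have ev' : v' = v.
  have [|_ E] := @mix_alone v v'; first by rewrite ev.
  by apply: alone_inj; rewrite -E -mv.
have fu : f u' = f u.
  apply: inj; rewrite ?M_Mb //; last by rewrite !mixM in eu.
  by apply: contra nK'; apply: meets_good_K.
by have := H _ u'M; rewrite fu eqxx /= -ev' a'.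
Qed.

Lemma mix_final (v : 'I_n) : mix n v = final e K M f budget top g alone v.
Proof.
rewrite mixE ltn_ord /= /final in_setU.
have [vM|vM] := boolP (v \in M).
  case: (v \in bd) => //=; case: (Some v =P g) => // gv.
  by have := g_good; rewrite -gv => /setDP [/disj_KM]; rewrite vM.
case: (v \in bd) => //=; case: ifP => // _.
by case: ifPn => vK; [rewrite three_K|rewrite three_0].
Qed.

Lemma sum_card (P : pred nat) (A : {set 'I_n}) :
  (forall v : 'I_n, P v = (v \in A)) -> \sum_(v < n) P v = #|A|.
Proof.
move=> PA; rewrite -sum1_card [RHS]big_mkcond /=; apply: eq_bigr => v _.
by rewrite PA; case: (v \in A).
Qed.

Lemma relabel_complete : independent e (~: (K :|: M)) ->
  exists2 g, g <= n & exists2 t, t < base ^ (2 * budget) &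
  let p := relabel k (unassigned k) n (lab, t) in
  accepts n k a (relabel k (lonely n k a) n (update p.1 g top, p.2)).1.
Proof.
move=> iW; exists gn; first by rewrite /gn; case: g => // y; apply/ltnW/ltn_ord.
have le := class_label_le sol cardM budget_top.
have lb v : v \in M :|: bd -> lbl v < base.
  by move=> /le /andP [_]; rewrite /lbl /base /top.
(* The second pass is treated first, as its tape [t2] is what the first pass has to leave over. *)
have [|v ltv vb|t2 lt2 E2] :=
    @relabelP k (lonely n k a) mark (on_ord 0 lbl) (update lab4 gn top) n _ _ 0.
- move=> v ltv; have := lonely_mix (Ordinal ltv).
  by rewrite -(on_ordE false (fun i => i \in bd)).
- move: vb; rewrite -[v]/(val (Ordinal ltv)) /mark !on_ordE => vb.
  exact: lb (bad_Mb vb).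
have [|v ltv vb|t1 lt1 E1] :=
    @relabelP k (unassigned k) (unassigned k lab) (on_ord 0 lbl) lab n _ _ t2.
- by move=> v ltv; rewrite /unassigned ltnn.
- rewrite -[v]/(val (Ordinal ltv)) on_ordE; apply/lb/M_Mb.
  by rewrite inE.
exists t1.
  apply: leq_trans lt1 _.
  rewrite (@sum_card _ M); last by move=> v; rewrite inE.
  apply: leq_trans (_ : base ^ #|M| * base ^ #|bd| <= _).
    rewrite leq_mul2l; apply/orP; right; rewrite muln1 in lt2.
    by rewrite -(@sum_card mark) // => v; rewrite /mark on_ordE.
  rewrite -expnD leq_exp2l; last by rewrite /base /budget; lia.
  have : #|bd| <= 2 * k := card_bad sol.
  by move: cardM; rewrite /budget; lia.
rewrite E1 /= E2 /=.
have Ef (v : 'I_n) : mix n v = final e K M f budget top g alone v by exact: mix_final.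
have nz := final_neq0 sol cardM budget_top alone_top g_good.
have cs : clique_side n (mix n) = K :|: M.
  by apply/setP => v; rewrite inE Ef nz.
have [X [XZ Xinj cost]] := final_transversal disj_KM sol cardM budget_top alone_inj alone_top g_good.
have Efun : (fun v : 'I_n => mix n v) = final e K M f budget top g alone.
  exact: functional_extensionality.
apply: (@accepts_complete n k a e a_e (mix n) X); rewrite ?cs ?Efun //.
- exact: (final_clique_classes e_sym disj_KM K_clique sol cardM budget_top alone_top g_good).
- by move=> u v uX vX; rewrite !Ef; apply: Xinj.
Qed.

End Relabelling.

Lemma labelling_complete (tT : finType) (Z : {set 'I_n}) (f : 'I_n -> tT) :
  solution e k Z f ->
  exists th w g tau, [/\ th <= n, w <= n, g <= n, tau < base ^ (6 * budget)
    & accepts n k a (labelling n k a th w g tau)].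
Proof.
move=> sol.
have [th leth co0] := init_coherent e_sym e_irr a_e sol.
have wle lab : coherent k Z f lab -> #|wrong k Z f lab| <= budget.
  by case=> _ _; apply: leq_trans; apply: leq_addl.
have [lab1 [co1 cf1 _ tape1]] := repair_complete a_e sol co0 (wle _ co0).
have [w lew [co2 sub2]] := remove_outsider a_e sol co1 cf1.
have [lab3 [co3 cf3 sub3 tape3]] := repair_complete a_e sol co2 (wle _ co2).
have KZ := subset_trans sub3 sub2; have [three MZ bound] := co3.
have cfP (u v : 'I_n) := cf3 u v.
have K_clique (u v : 'I_n) : u \in lone n k lab3 -> v \in lone n k lab3 -> u != v -> e u v.
  rewrite !inE => ul vl uv; have := cfP u v.
  rewrite /conflict ul vl a_e -[_ != _]/(u != v) uv /=.
  by case: (e u v).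
(* The zero labels form an independent set containing [~: Z], so their vertices in [Z] may leave
   [Z]. This can change the classes: lone vertices may no longer be alone, and the bound [2 * k] is
   applied anew to [f']. *)
pose X := [set v : 'I_n | (lab3 v == 0) && (v \in Z)].
have XZ : X \subset Z by apply/subsetP => v; rewrite inE => /andP [].
have WX (v : 'I_n) : v \in ~: Z :|: X -> lab3 v = 0.
  rewrite !inE => /orP [vZ|/andP [/eqP //]].
  case/or3P: (three v) => /eqP // E.
    by case/negP: vZ; apply: (subsetP MZ); rewrite inE E.
  by case/negP: vZ; apply: (subsetP KZ); rewrite inE E ltnS leq_addr.
have iWX : independent e (~: Z :|: X).
  move=> u v /WX u0 /WX v0; have := cfP u v.
  by rewrite /conflict u0 v0 a_e /=.
have [f' sol'] := solution_setD sol XZ iWX.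
have ZE : Z :\: X = lone n k lab3 :|: pending n k lab3.
  apply/setP => v; rewrite in_setD in_setU; apply/andP/orP => [[vX vZ]|h].
    move: vX; rewrite !inE vZ andbT; case/or3P: (three v) => /eqP ->; [by []|by right|].
    by left; rewrite ltnS leq_addr.
  have vZ : v \in Z by case: h => [/(subsetP KZ)|/(subsetP MZ)].
  rewrite inE vZ andbT; split=> //; case: h; rewrite inE.
    by apply: contraL => /eqP ->.
  by move=> /eqP ->.
rewrite ZE in sol'.
have cardM : #|pending n k lab3| <= budget by apply: leq_trans bound; apply: leq_addr.
have [|g leg [t lt acc]] := relabel_complete three K_clique sol' cardM.
  by case: sol'.
have [t3 lt3 E3] := tape3 t; have [t1 lt1 E1] := tape1 t3.
exists th, w, g, t1; split=> //; last first.
  by rewrite /labelling E1 /= E3.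
apply: leq_trans lt1 _; apply: leq_trans (leq_mul (leqnn _) lt3) _.
apply: leq_trans (leq_mul (leqnn _) (leq_mul (leqnn _) lt)) _.
by rewrite -!expnD leq_exp2l; [lia|rewrite /base /budget; lia].
Qed.

End Completeness.

(** * The program *)

Arguments sem : simpl never.
Arguments eval : simpl never.
Arguments set_reg : simpl never.
Arguments set_mem : simpl never.

Lemma sem_Nop s : sem Nop s = s. Proof. by []. Qed.
Lemma sem_Asn r e s : sem (Asn r e) s = set_reg s r (eval e s). Proof. by []. Qed.
Lemma sem_Write d e s : sem (Write d e) s = set_mem s (eval d s) (eval e s).
Proof. by []. Qed.
Lemma sem_Then c d s : sem (Then c d) s = sem d (sem c s). Proof. by []. Qed.

Definition holds (e : expr) (s : state) : bool := eval e s != 0.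

Lemma sem_Cond e c d s : sem (Cond e c d) s = if holds e s then sem c s else sem d s.
Proof. by []. Qed.

Definition semE := (sem_Nop, sem_Asn, sem_Write, sem_Then, sem_Cond).

Lemma eval_Reg r s : eval (Reg r) s = reg s r. Proof. by []. Qed.
Lemma eval_Lit c s : eval (Lit c) s = c. Proof. by []. Qed.
Lemma eval_Plus x y s : eval (Plus x y) s = eval x s + eval y s. Proof. by []. Qed.
Lemma eval_Minus x y s : eval (Minus x y) s = eval x s - eval y s. Proof. by []. Qed.
Lemma eval_Read x s : eval (Read x) s = mem s (eval x s). Proof. by []. Qed.

Definition evalE := (eval_Reg, eval_Lit, eval_Plus, eval_Minus, eval_Read).

Definition LtE x y := Minus y x.
Definition NotE x := Minus (Lit 1) x.
Definition LeE x y := NotE (Minus x y).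
Definition EqE x y := NotE (Plus (Minus x y) (Minus y x)).
Definition AndE x y := NotE (Plus (NotE x) (NotE y)).
Definition OrE x y := Plus x y.

Lemma holds_Lt x y s : holds (LtE x y) s = (eval x s < eval y s).
Proof. rewrite /holds evalE; lia. Qed.
Lemma holds_Not x s : holds (NotE x) s = ~~ holds x s.
Proof. by rewrite /holds !evalE; lia. Qed.
Lemma holds_Le x y s : holds (LeE x y) s = (eval x s <= eval y s).
Proof. rewrite holds_Not /holds evalE; lia. Qed.
Lemma holds_Eq x y s : holds (EqE x y) s = (eval x s == eval y s).
Proof. rewrite holds_Not /holds !evalE; lia. Qed.
Lemma holds_And x y s : holds (AndE x y) s = holds x s && holds y s.
Proof. by rewrite /holds !evalE; lia. Qed.
Lemma holds_Or x y s : holds (OrE x y) s = holds x s || holds y s.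
Proof. by rewrite /holds !evalE; lia. Qed.
Lemma holds_Reg r s : holds (Reg r) s = (reg s r != 0). Proof. by []. Qed.

Opaque LtE NotE LeE EqE AndE OrE.

Definition holdsE := (holds_Lt, holds_Not, holds_Le, holds_Eq, holds_And, holds_Or,
  holds_Reg).

Lemma reg_set s r x r' : reg (set_reg s r x) r' = if r' == r then x else reg s r'.
Proof. by []. Qed.
Lemma mem_set s r x : mem (set_reg s r x) = mem s. Proof. by []. Qed.
Lemma reg_set_mem s b x : reg (set_mem s b x) = reg s. Proof. by []. Qed.

Lemma for_ind i b c s (I : nat -> state -> Prop) :
  I 0 (set_reg s i 0) ->
  (forall j s', j < reg s b -> I j s' -> I j.+1 (incr i (sem c s'))) ->
  I (reg s b) (sem (For i b c) s).
Proof.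
move=> I0 IS; rewrite [sem _ _]/(iter (reg s b) _ _).
elim: {-2}(reg s b) (leqnn (reg s b)) => [|m IH] //= lem.
by apply: IS => //; apply: IH; apply: ltnW.
Qed.

Definition same (X : seq nat) (s s' : state) : Prop :=
  mem s' = mem s /\ forall r, r \notin X -> reg s' r = reg s r.

Lemma same_sem c s : ~~ writes c -> same (assigned c) s (sem c s).
Proof. by move=> w; split; [exact: mem_sem_frame|move=> r; exact: reg_sem_frame]. Qed.

(* Register 0 holds the number of vertices throughout. *)
Definition LastC (out i : nat) (c : cmd) (t : expr) : cmd :=
  Then (Asn out (Reg 0))
    (For i 0 (Then c (Cond t (Asn out (Reg i)) Nop))).

Definition SumC (out i : nat) (c : cmd) (t : expr) : cmd :=
  Then (Asn out (Lit 0))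
    (For i 0 (Then c (Cond t (Asn out (Plus (Reg out) (Lit 1))) Nop))).

Definition loop_ok (out i : nat) (c : cmd) : bool :=
  [&& out \notin i :: 0 :: assigned c, i \notin 0 :: assigned c,
      0 \notin assigned c & ~~ writes c].

Lemma LastC_spec out i c t s (P : pred nat) : loop_ok out i c ->
  (forall s', same (out :: i :: assigned c) s s' -> reg s' i < reg s 0 ->
     holds t (sem c s') = P (reg s' i)) ->
  reg (sem (LastC out i c t) s) out = last_sat P (reg s 0) (reg s 0).
Proof.
move=> /and4P []; rewrite !inE !negb_or => /and3P [oi o0 oc] /andP [i0 ic] zc wc H.
rewrite /LastC !semE evalE; set n := reg s 0; set s0 := set_reg _ _ _.
have n0 : reg s0 0 = n by rewrite reg_set eq_sym (negbTE o0).
pose X := out :: i :: assigned c.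
have := @for_ind i 0 (Then c (Cond t (Asn out (Reg i)) Nop)) s0
  (fun j s' => [/\ same X s s', reg s' i = j & reg s' out = last_sat P n j]).
rewrite n0; case=> [|j s' ltj [sm ij oj]|_ _ //].
  split; [split=> // r|by rewrite reg_set eqxx|].
    by rewrite !inE !negb_or !reg_set => /and3P [/negbTE -> /negbTE -> _].
  by rewrite !reg_set (negbTE oi) eqxx.
have h := H s' sm; rewrite ij in h; have {}h := h ltj.
have [mc rc] := same_sem s' wc; have [m' r'] := sm.
rewrite /incr !semE h evalE [last_sat P n j.+1]/=.
split; [split=> [|r]| |].
- by case: (P j); rewrite !mem_set mc.
- rewrite !inE !negb_or => /and3P [ro ri rcc].
  by rewrite !reg_set (negbTE ri); case: (P j); rewrite ?reg_set ?(negbTE ro) rc //;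
    rewrite r' // !inE !negb_or ro ri.
- by case: (P j); rewrite !reg_set eqxx ?[i == out]eq_sym ?(negbTE oi) rc ?ij.
- by rewrite !reg_set (negbTE oi); case: (P j); rewrite ?reg_set ?eqxx rc.
Qed.

Lemma SumC_spec out i c t s (P : pred nat) : loop_ok out i c ->
  (forall s', same (out :: i :: assigned c) s s' -> reg s' i < reg s 0 ->
     holds t (sem c s') = P (reg s' i)) ->
  reg (sem (SumC out i c t) s) out = \sum_(j < reg s 0) P j.
Proof.
move=> /and4P []; rewrite !inE !negb_or => /and3P [oi o0 oc] /andP [i0 ic] zc wc H.
rewrite /SumC !semE evalE; set n := reg s 0; set s0 := set_reg _ _ _.
have n0 : reg s0 0 = n by rewrite reg_set eq_sym (negbTE o0).
pose X := out :: i :: assigned c.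
have := @for_ind i 0 (Then c (Cond t (Asn out (Plus (Reg out) (Lit 1))) Nop)) s0
  (fun j s' => [/\ same X s s', reg s' i = j & reg s' out = \sum_(q < j) P q]).
rewrite n0; case=> [|j s' ltj [sm ij oj]|_ _ //].
  split; [split=> // r|by rewrite reg_set eqxx|].
    by rewrite !inE !negb_or !reg_set => /and3P [/negbTE -> /negbTE -> _].
  by rewrite !reg_set (negbTE oi) eqxx big_ord0.
have h := H s' sm; rewrite ij in h; have {}h := h ltj.
have [mc rc] := same_sem s' wc; have [m' r'] := sm.
rewrite /incr !semE h !evalE big_ord_recr [X in _ = X + _]/= [nat_of_ord ord_max]/=.
split; [split=> [|r]| |].
- by case: (P j); rewrite !mem_set mc.
- rewrite !inE !negb_or => /and3P [ro ri rcc].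
  by rewrite !reg_set (negbTE ri); case: (P j); rewrite ?reg_set ?(negbTE ro) rc //;
    rewrite r' // !inE !negb_or ro ri.
- by case: (P j); rewrite !reg_set eqxx ?[i == out]eq_sym ?(negbTE oi) rc ?ij.
- by rewrite !reg_set (negbTE oi); case: (P j); rewrite ?reg_set ?eqxx rc // oj ?addn0.
Qed.

(** The row offset is found without multiplication, by adding [n] for each row number below that of
    [x]. Looping up to register 0 rather than [x] keeps the bound in a register that the search does
    not assign. *)
Definition AdjC (x y out : nat) : cmd :=
  Then (Asn 14 (Lit 0)) (Then
    (For 13 0 (Cond (LtE (Reg 13) (Reg x)) (Asn 14 (Plus (Reg 14) (Reg 0))) Nop))
    (Asn out (Read (Plus (Reg 14) (Reg y))))).

Lemma AdjC_spec x y out s : 14 < x -> 14 < y -> reg s x < reg s 0 ->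
  reg (sem (AdjC x y out) s) out = mem s (reg s x * reg s 0 + reg s y).
Proof.
move=> x14 y14 ltx; rewrite /AdjC !semE reg_set eqxx.
set s0 := set_reg s 14 _; set c := Cond _ _ _.
have x13 : (x == 13) = false by apply: gtn_eqF; apply: ltnW.
have x14' : (x == 14) = false by apply: gtn_eqF.
have y13 : (y == 13) = false by apply: gtn_eqF; apply: ltnW.
have y14' : (y == 14) = false by apply: gtn_eqF.
have := @for_ind 13 0 c s0
  (fun j s' => [/\ same [:: 13; 14] s s', reg s' 13 = j
     & reg s' 14 = minn j (reg s x) * reg s 0]).
rewrite [reg s0 0]/(reg s 0); case=> [|j s' ltj [[m' r'] ij aj]|[m' r'] _ aj].
- split=> //; last by rewrite min0n.
  split=> // r; rewrite !inE negb_or => /andP [/negbTE h1 /negbTE h2].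
  by rewrite !reg_set h1 h2.
- have rx : reg s' x = reg s x by rewrite r' // !inE x13 x14'.
  have r0 : reg s' 0 = reg s 0 by rewrite r'.
  rewrite /incr /c !semE !holdsE !evalE rx r0 ij aj; case: ltnP => jx; split=> //.
  + split=> // r; rewrite !inE negb_or => /andP [h1 h2].
    by rewrite !reg_set (negbTE h1) (negbTE h2) r' // !inE negb_or h1.
  + by rewrite !reg_set /= ij.
  + by rewrite !reg_set /=; nia.
  + split=> // r; rewrite !inE negb_or => /andP [h1 h2].
    by rewrite !reg_set (negbTE h1) r' // !inE negb_or h1.
  + by rewrite !reg_set /= ij.
  + by rewrite !reg_set /= aj; nia.
- rewrite !evalE m' aj (minn_idPr (ltnW ltx)); congr (mem s (_ + _)).
  by rewrite r' // !inE y13 y14'.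
Qed.

(* The digits of the guesses are taken from register 11; register 2 holds    *)
(* the base, register 4 an upper bound on the quotient, and the digit is     *)
(* returned in register 15.                                                  *)
Definition ChooseC : cmd :=
  Then (Asn 16 (Lit 0)) (Then (Asn 15 (Reg 11)) (Then
    (For 13 4 (Cond (LeE (Reg 2) (Reg 15))
       (Then (Asn 15 (Minus (Reg 15) (Reg 2))) (Asn 16 (Plus (Reg 16) (Lit 1)))) Nop))
    (Asn 11 (Reg 16)))).

(** Division by repeated subtraction: [minn] in the invariant expresses that the rounds after the
    last possible subtraction are idle. *)
Lemma ChooseC_spec s : 0 < reg s 2 -> reg s 11 <= reg s 4 ->
  reg (sem ChooseC s) 11 = reg s 11 %/ reg s 2 /\
  reg (sem ChooseC s) 15 = reg s 11 %% reg s 2.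
Proof.
move=> b0 leN; rewrite /ChooseC !semE !reg_set /= !evalE.
set s0 := set_reg _ 15 _; set c := Cond _ _ _; set b := reg s 2 in b0 *.
set t := reg s 11 in leN *.
have := @for_ind 13 4 c s0 (fun j s' => [/\ reg s' 2 = b,
  reg s' 16 = minn j (t %/ b) & reg s' 15 = t - minn j (t %/ b) * b]).
have tb := leq_divM t b; have tm := divn_eq t b; have tl := ltn_pmod t b0.
have lq : t %/ b <= t by apply: leq_div.
rewrite [reg s0 4]/(reg s 4); case=> [|j s' ltj [h2 h16 h15]|h2 h16 h15].
- by rewrite !reg_set /= min0n subn0.
- rewrite /incr /c !semE !holdsE !evalE h2 h15; case: (leqP b) => jb; rewrite !reg_set /=.
  + rewrite /= ?h2 ?h15 ?h16.
    have -> : minn j (t %/ b) = j by nia.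
    have -> : minn j.+1 (t %/ b) = j.+1.
      have : j < t %/ b by nia.
      lia.
    by split=> //; nia.
  + have E : minn j (t %/ b) = t %/ b by nia.
    have -> : minn j.+1 (t %/ b) = t %/ b by lia.
    by rewrite h2 h16 h15 E.
- rewrite h16 h15 (minn_idPr (leq_trans lq leN)).
  by split=> //; rewrite {1}tm addKn.
Qed.

(** * The program that tests one combination of guesses *)

Definition LabE (r : nat) : expr := Read (Plus (Reg 5) (Reg r)).
Lemma LabE_def r : LabE r = Read (Plus (Reg 5) (Reg r)).
Proof. by []. Qed.
Opaque LabE.

Definition ConflictE : expr :=
  OrE (AndE (LtE (Reg 2) (LabE 20)) (AndE (LtE (Reg 2) (LabE 21))
        (AndE (NotE (EqE (Reg 20) (Reg 21))) (NotE (Reg 18)))))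
      (AndE (EqE (LabE 20) (Lit 0)) (AndE (EqE (LabE 21) (Lit 0)) (Reg 18))).

Definition FindYC : cmd := LastC 25 21 (AdjC 20 21 18) ConflictE.
Definition FindXC : cmd := LastC 24 20 FindYC (LtE (Reg 25) (Reg 0)).

Definition RepairC : cmd :=
  Then FindXC (Cond (LtE (Reg 24) (Reg 0))
    (Then (Asn 20 (Reg 24)) (Then FindYC (Then ChooseC
    (Then (Cond (Reg 15) (Asn 26 (Reg 20)) (Asn 26 (Reg 25)))
    (Then ChooseC (Cond (Reg 15)
      (Write (Plus (Reg 5) (Reg 26)) (Reg 2))
      (Write (Plus (Reg 5) (Reg 26)) (Lit 0))))))))
    Nop).

Definition ClassAdjInnerC : cmd :=
  LastC 32 30 (AdjC 29 30 18)
    (AndE (EqE (LabE 29) (LabE 27)) (AndE (EqE (LabE 30) (LabE 28)) (Reg 18))).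
Definition ClassAdjC : cmd := LastC 31 29 ClassAdjInnerC (LtE (Reg 32) (Reg 0)).

Definition LonelyC : cmd :=
  LastC 33 27 ClassAdjC (AndE (LtE (Lit 0) (LabE 27))
    (AndE (LeE (LabE 27) (Reg 3)) (NotE (LtE (Reg 31) (Reg 0))))).
Definition LonelyE : expr := AndE (LtE (Reg 2) (LabE 28)) (LtE (Reg 33) (Reg 0)).

Definition UnassignedE : expr := EqE (LabE 28) (Reg 2).

Definition RelabelC (c : cmd) (t : expr) : cmd :=
  For 28 0 (Then c (Cond t
    (Then ChooseC (Write (Plus (Reg 5) (Reg 28)) (Reg 15))) Nop)).

Definition ViolationInnerC : cmd :=
  LastC 35 28 (Then ClassAdjC (AdjC 27 28 18))
    (OrE (AndE (EqE (LabE 27) (Lit 0)) (AndE (EqE (LabE 28) (Lit 0)) (Reg 18)))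
         (AndE (NotE (EqE (LabE 27) (Lit 0))) (AndE (NotE (EqE (LabE 28) (Lit 0)))
            (AndE (NotE (EqE (LabE 27) (LabE 28))) (NotE (LtE (Reg 31) (Reg 0))))))).
Definition ViolationC : cmd := LastC 34 27 ViolationInnerC (LtE (Reg 35) (Reg 0)).

Definition EarlierC : cmd :=
  LastC 33 27 Nop (AndE (LtE (Reg 27) (Reg 28)) (EqE (LabE 27) (LabE 28))).
Definition CostC : cmd :=
  SumC 37 28 EarlierC
    (AndE (NotE (EqE (LabE 28) (Lit 0))) (LtE (Reg 33) (Reg 0))).

Definition DegreeC : cmd := SumC 35 27 (AdjC 28 27 18) (Reg 18).
Definition InitC : cmd :=
  Then (Write (Plus (Reg 5) (Reg 0)) (Lit 0))
    (For 28 0 (Then DegreeC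
      (Cond (LeE (Reg 7) (Reg 35))
        (Write (Plus (Reg 5) (Reg 28)) (Plus (Plus (Reg 2) (Lit 1)) (Reg 28)))
        (Write (Plus (Reg 5) (Reg 28)) (Lit 0))))).

(* Registers 7, 8 and 9 hold the guessed threshold, the guessed independent  *)
(* vertex of K and the guessed g, register 10 the number whose digits are    *)
(* the other guesses, and register 12 the answer.                            *)
Definition TestC : cmd :=
  Then (Asn 11 (Reg 10)) (Then InitC (Then (For 36 3 RepairC)
  (Then (Write (Plus (Reg 5) (Reg 8)) (Lit 0)) (Then (For 36 3 RepairC)
  (Then (RelabelC Nop UnassignedE)
  (Then (Write (Plus (Reg 5) (Reg 9)) (Plus (Reg 3) (Reg 3)))
  (Then (RelabelC LonelyC LonelyE) (Then ViolationC (Then CostC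
    (Cond (AndE (NotE (LtE (Reg 34) (Reg 0))) (LeE (Reg 37) (Reg 1)))
      (Asn 12 (Lit 1)) Nop)))))))))).

Definition SearchC : cmd := For 7 6 (For 8 6 (For 9 6 (For 10 4 TestC))).

(** * Correctness of the test *)

Section Context.
Variables (n k N : nat) (a : nat -> nat -> bool).

(* The labels are stored behind the adjacency matrix; there is a dummy cell  *)
(* for the nonexistent vertex n.                                             *)
Record ctx (s : state) : Prop := Ctx {
  ctx0 : reg s 0 = n;
  ctx1 : reg s 1 = k;
  ctx2 : reg s 2 = base k;
  ctx3 : reg s 3 = budget k;
  ctx4 : reg s 4 = N;
  ctx5 : reg s 5 = n * n;
  ctx6 : reg s 6 = n.+1;
  ctx_adj : forall i j, i < n -> j < n -> (mem s (i * n + j) != 0) = a i j;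
  ctx_clean : forall v, n < v -> mem s (n * n + v) = 0
}.

Definition lab_of (s : state) : nat -> nat := fun v => mem s (n * n + v).

Lemma ctx_same X s s' : same X s s' -> all (leq 7) X -> ctx s -> ctx s'.
Proof.
move=> [m r] X7 C.
have F q : q < 7 -> reg s' q = reg s q.
  move=> ltq; apply: r; apply/negP => /(allP X7); lia.
by split; rewrite ?m ?F //; case: C.
Qed.

Lemma ctx_sem c s : ~~ writes c -> all (leq 7) (assigned c) -> ctx s ->
  ctx (sem c s) /\ lab_of (sem c s) = lab_of s.
Proof.
move=> w A C; split; first exact: ctx_same (same_sem s w) A C.
by rewrite /lab_of mem_sem_frame.
Qed.

Lemma lab_same X s s' : same X s s' -> lab_of s' = lab_of s.
Proof. by rewrite /lab_of => -[-> _]. Qed.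

Lemma eval_Lab r s : ctx s -> eval (LabE r) s = lab_of s (reg s r).
Proof. by move=> C; rewrite LabE_def !evalE (ctx5 C). Qed.

Lemma ctx_set s r x : 6 < r -> ctx s -> ctx (set_reg s r x).
Proof.
move=> r7; apply: (@ctx_same [:: r]); last by rewrite /= r7.
by split=> // q; rewrite inE reg_set => /negbTE ->.
Qed.

Lemma ctx_write s v x : v <= n -> ctx s ->
  ctx (set_mem s (n * n + v) x) /\
  lab_of (set_mem s (n * n + v) x) = update (lab_of s) v x.
Proof.
move=> lev C; split.
  split; rewrite ?reg_set_mem; try by case: C.
  - move=> i j lti ltj; rewrite [mem _ _]/(update _ _ _ _) /update.
    rewrite (_ : (i * n + j == n * n + v) = false); first exact: (ctx_adj C).
    apply: ltn_eqF; apply: leq_trans (leq_addr _ _).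
    have := leq_mul lti (leqnn n); rewrite mulSn; lia.
  - move=> u ltu; rewrite [mem _ _]/(update _ _ _ _) /update eqn_add2l.
    by rewrite gtn_eqF ?(ctx_clean C) //; apply: leq_ltn_trans ltu.
apply: functional_extensionality => u.
by rewrite /lab_of [mem _ _]/(update _ _ _ _) /update eqn_add2l.
Qed.

Lemma adj_spec x y s : 14 < x -> 14 < y -> ctx s -> reg s x < n -> reg s y < n ->
  (reg (sem (AdjC x y 18) s) 18 != 0) = a (reg s x) (reg s y).
Proof.
move=> hx hy C lx ly; rewrite AdjC_spec ?(ctx0 C) //; exact: (ctx_adj C).
Qed.

Lemma findY_spec s : ctx s -> reg s 20 < n ->
  reg (sem FindYC s) 25 = last_sat (conflict k a (lab_of s) (reg s 20)) n n.
Proof.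
move=> C lx; rewrite -[in RHS](ctx0 C); apply: LastC_spec => // s' sm.
rewrite (ctx0 C) => ly; have C' := ctx_same sm isT C.
have [D L] := ctx_sem (c := AdjC 20 21 18) isT isT C'.
have E20 : reg s' 20 = reg s 20 by case: sm => _ ->.
rewrite !holdsE !(eval_Lab _ D) L !evalE adj_spec ?E20 //.
by rewrite !reg_sem_frame // (ctx2 C') E20 (lab_same sm).
Qed.

Lemma findX_spec s : ctx s -> reg (sem FindXC s) 24 =
  last_sat (fun x => ex_below n (conflict k a (lab_of s) x)) n n.
Proof.
move=> C; rewrite -[in RHS](ctx0 C) (ctx0 C).
rewrite -[X in last_sat _ X X](ctx0 C); apply: LastC_spec => // s' sm.
rewrite (ctx0 C) => lx; have C' := ctx_same sm isT C.
rewrite !holdsE !evalE findY_spec // (lab_same sm).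
by rewrite reg_sem_frame // (ctx0 C').
Qed.

Lemma choose_spec s : ctx s -> reg s 11 <= N ->
  [/\ ctx (sem ChooseC s), lab_of (sem ChooseC s) = lab_of s,
    reg (sem ChooseC s) 11 = reg s 11 %/ base k
    & reg (sem ChooseC s) 15 = reg s 11 %% base k].
Proof.
move=> C le; have [D L] := ctx_sem (c := ChooseC) isT isT C.
have [||h1 h2] := @ChooseC_spec s; rewrite ?(ctx2 C) ?(ctx4 C) //.
by split=> //; rewrite -(ctx2 C).
Qed.

Lemma repair_prog s : ctx s -> reg s 11 <= N ->
  [/\ ctx (sem RepairC s),
    (lab_of (sem RepairC s), reg (sem RepairC s) 11)
      = repair n k a (lab_of s, reg s 11)
    & reg (sem RepairC s) 11 <= N].
Proof.
move=> C leN; rewrite /RepairC /repair sem_Then sem_Cond /=.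
have [C1 L1] := ctx_sem (c := FindXC) isT isT C.
have t1 : reg (sem FindXC s) 11 = reg s 11 by rewrite reg_sem_frame.
rewrite holds_Lt !eval_Reg (ctx0 C1) findX_spec //.
set x := last_sat _ n n; case: ifP => ltx; last by rewrite sem_Nop L1 t1.
have x24 : reg (sem FindXC s) 24 = x by rewrite findX_spec.
set s1 := sem FindXC s in C1 L1 t1 x24 *; clearbody s1.
rewrite sem_Then sem_Asn eval_Reg x24.
have C2 : ctx (set_reg s1 20 x) by apply: ctx_set.
have L2 : lab_of (set_reg s1 20 x) = lab_of s by [].
set s2 := set_reg s1 20 x in C2 L2 *.
have x2 : reg s2 20 = x by [].
have t2 : reg s2 11 = reg s 11 by [].
clearbody s2; rewrite sem_Then.
have [C3 L3] := ctx_sem (c := FindYC) isT isT C2.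
have y3 := findY_spec C2; rewrite x2 L2 in y3; have {}y3 := y3 ltx.
set y := last_sat _ n n in y3 *.
have x3 : reg (sem FindYC s2) 20 = x by rewrite reg_sem_frame.
have t3 : reg (sem FindYC s2) 11 = reg s 11 by rewrite reg_sem_frame.
set s3 := sem FindYC s2 in C3 L3 x3 y3 t3 *; clearbody s3.
rewrite sem_Then.
have [|C4 L4 t4 d4] := choose_spec C3; first by rewrite t3.
have x4 : reg (sem ChooseC s3) 20 = x by rewrite reg_sem_frame.
have y4 : reg (sem ChooseC s3) 25 = y by rewrite reg_sem_frame.
set s4 := sem ChooseC s3 in C4 L4 x4 y4 t4 d4 *; clearbody s4.
rewrite sem_Then sem_Cond holds_Reg d4 t3 !sem_Asn !eval_Reg x4 y4.
set v := if reg s 11 %% base k != 0 then x else y.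
have -> : (if reg s 11 %% base k != 0 then set_reg s4 26 x else set_reg s4 26 y)
  = set_reg s4 26 v by rewrite /v; case: ifP.
have C5 : ctx (set_reg s4 26 v) by apply: ctx_set.
have L5 : lab_of (set_reg s4 26 v) = lab_of s by rewrite -L2 -L3 -L4.
have t5 : reg (set_reg s4 26 v) 11 = reg s 11 %/ base k by rewrite reg_set /= t4 t3.
have v5 : reg (set_reg s4 26 v) 26 = v by rewrite reg_set.
set s5 := set_reg s4 26 v in C5 L5 t5 v5 *; clearbody s5.
rewrite sem_Then.
have le5 : reg s5 11 <= N by rewrite t5; apply: leq_trans (leq_div _ _) leN.
have [C6 L6 t6 d6] := choose_spec C5 le5.
have v6 : reg (sem ChooseC s5) 26 = v by rewrite reg_sem_frame.
set s6 := sem ChooseC s5 in C6 L6 t6 d6 v6 *; clearbody s6.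
have lev : v <= n.
  have ley : y <= n by rewrite /y; case: last_satP => // z _; apply: ltnW.
  by rewrite /v; case: ifP => // _; apply: ltnW.
rewrite sem_Cond holds_Reg d6 !sem_Write !evalE (ctx5 C6) (ctx2 C6) v6 t5.
set c := if (reg s 11 %/ base k) %% base k != 0 then base k else 0.
have -> : (if (reg s 11 %/ base k) %% base k != 0
    then set_mem s6 (n * n + v) (base k) else set_mem s6 (n * n + v) 0)
  = set_mem s6 (n * n + v) c by rewrite /c; case: ifP.
have [C7 L7] := ctx_write c lev C6.
rewrite L7 reg_set_mem L6 L5 t6 t5; split=> //.
by apply: leq_trans (leq_div _ _) _; rewrite -t5.
Qed.

Lemma classadj_inner_spec s : ctx s -> reg s 29 < n ->
  reg (sem ClassAdjInnerC s) 32 = last_sat (fun v' =>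
    [&& lab_of s (reg s 29) == lab_of s (reg s 27),
        lab_of s v' == lab_of s (reg s 28) & a (reg s 29) v']) n n.
Proof.
move=> C lx; rewrite -[X in last_sat _ X X](ctx0 C); apply: LastC_spec => // s' sm.
rewrite (ctx0 C) => ly; have C' := ctx_same sm isT C.
have [D L] := ctx_sem (c := AdjC 29 30 18) isT isT C'.
have [_ F] := sm; have F29 : reg s' 29 = reg s 29 by rewrite F.
rewrite !holdsE !(eval_Lab _ D) L adj_spec ?F29 //.
by rewrite !reg_sem_frame // F29 [reg s' 27]F // [reg s' 28]F // (lab_same sm).
Qed.

Lemma classadj_spec s : ctx s ->
  (reg (sem ClassAdjC s) 31 < n) = class_adj n a (lab_of s) (reg s 27) (reg s 28).
Proof.
move=> C; rewrite /class_adj; congr (_ < n).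
rewrite -[X in last_sat _ X X](ctx0 C); apply: LastC_spec => // s' sm.
rewrite (ctx0 C) => lx; have C' := ctx_same sm isT C.
rewrite !holdsE !evalE classadj_inner_spec // (lab_same sm).
have [_ F] := sm; rewrite [reg s' 27]F // [reg s' 28]F //.
by rewrite reg_sem_frame // (ctx0 C').
Qed.

Lemma lonely_spec s : ctx s ->
  holds LonelyE (sem LonelyC s) = lonely n k a (lab_of s) (reg s 28).
Proof.
move=> C; have [D L] := ctx_sem (c := LonelyC) isT isT C.
rewrite /LonelyE !holdsE !(eval_Lab _ D) L !evalE (ctx0 D) (ctx2 D) /lonely.
rewrite [reg _ 28]reg_sem_frame //; congr (_ && (_ < n)).
rewrite -[X in last_sat _ X X](ctx0 C); apply: LastC_spec => // s' sm.
rewrite (ctx0 C) => lu; have C' := ctx_same sm isT C.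
have [D' L'] := ctx_sem (c := ClassAdjC) isT isT C'.
rewrite !holdsE !(eval_Lab _ D') L' !evalE (ctx0 D') (ctx3 D') classadj_spec //.
by have [_ F] := sm; rewrite reg_sem_frame // (lab_same sm) [reg s' 28]F.
Qed.

Lemma unassigned_spec s : ctx s ->
  holds UnassignedE (sem Nop s) = unassigned k (lab_of s) (reg s 28).
Proof. by move=> C; rewrite sem_Nop /UnassignedE !holdsE (eval_Lab _ C) evalE (ctx2 C). Qed.

Lemma relabel_prog c t cond s :
  (forall s', ctx s' -> holds t (sem c s') = cond (lab_of s') (reg s' 28)) ->
  ~~ writes c -> all (leq 7) (assigned c) -> 11 \notin assigned c ->
  28 \notin assigned c -> ctx s -> reg s 11 <= N ->
  let s' := sem (RelabelC c t) s in
  [/\ ctx s', (lab_of s', reg s' 11) = relabel k cond n (lab_of s, reg s 11)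
    & reg s' 11 <= N].
Proof.
move=> H w A c11 c28 C leN; rewrite /= /RelabelC; set body := Then _ _.
have := @for_ind 28 0 body s (fun j s' => [/\ ctx s', reg s' 28 = j,
  (lab_of s', reg s' 11) = relabel k cond j (lab_of s, reg s 11)
  & reg s' 11 <= N]).
rewrite (ctx0 C); case=> [|j s' ltj [C' ij E le]|C' _ E le].
- by split=> //; apply: ctx_set.
- have [D L] := ctx_sem w A C'.
  have r28 : reg (sem c s') 28 = j by rewrite reg_sem_frame.
  have r11 : reg (sem c s') 11 = reg s' 11 by rewrite reg_sem_frame.
  have -> : relabel k cond j.+1 (lab_of s, reg s 11) = if cond (lab_of s') j
      then (update (lab_of s') j (reg s' 11 %% base k), reg s' 11 %/ base k)
      else (lab_of s', reg s' 11) by rewrite /= -E.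
  rewrite /body sem_Then sem_Cond H // ij.
  case: ifP => cj; rewrite /incr; last first.
    rewrite sem_Nop; split; [exact: ctx_set| |by rewrite -r11 -L|by rewrite reg_set r11].
    by rewrite reg_set r28.
  rewrite sem_Then sem_Write !evalE.
  have [|D2 L2 t2 d2] := choose_spec D; first by rewrite r11.
  have v2 : reg (sem ChooseC (sem c s')) 28 = j by rewrite reg_sem_frame.
  rewrite (ctx5 D2) v2 d2 r11.
  have [D3 L3] := ctx_write (reg s' 11 %% base k) (ltnW ltj) D2.
  set s3 := set_mem _ _ _ in D3 L3 *.
  have t3 : reg s3 11 = reg s' 11 %/ base k by rewrite reg_set_mem t2 r11.
  have v3 : reg s3 28 = j by rewrite reg_set_mem v2.
  clearbody s3; split; first exact: ctx_set.
  + by rewrite reg_set v3.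
  + by rewrite reg_set /= t3 -[lab_of (set_reg _ _ _)]/(lab_of s3) L3 L2 L.
  + by rewrite reg_set /= t3; apply: leq_trans (leq_div _ _) le.
- by split.
Qed.

Lemma violation_inner_spec s : ctx s -> reg s 27 < n ->
  reg (sem ViolationInnerC s) 35 = last_sat (fun v =>
    if lab_of s (reg s 27) == 0 then (lab_of s v == 0) && a (reg s 27) v
    else [&& lab_of s v != 0, lab_of s (reg s 27) != lab_of s v
           & ~~ class_adj n a (lab_of s) (reg s 27) v]) n n.
Proof.
move=> C lu; rewrite -[X in last_sat _ X X](ctx0 C); apply: LastC_spec => // s' sm.
rewrite (ctx0 C) => lv; have C' := ctx_same sm isT C.
have [D L] := ctx_sem (c := ClassAdjC) isT isT C'.
have [D2 L2] := ctx_sem (c := AdjC 27 28 18) isT isT D.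
have [_ F] := sm; have F27 : reg s' 27 = reg s 27 by rewrite F.
have h27 : reg (sem ClassAdjC s') 27 = reg s 27 by rewrite reg_sem_frame.
have h28 : reg (sem ClassAdjC s') 28 = reg s' 28 by rewrite reg_sem_frame.
rewrite sem_Then !holdsE !(eval_Lab _ D2) L2 L !evalE.
rewrite adj_spec ?h27 ?h28 // (ctx0 D2).
rewrite ![reg (sem (AdjC _ _ _) _) _]reg_sem_frame // h27 h28.
rewrite classadj_spec // F27 (lab_same sm).
by case: (lab_of s (reg s 27) == 0); rewrite //= orbF.
Qed.

Lemma violation_spec s : ctx s ->
  (reg (sem ViolationC s) 34 < n) = violation n a (lab_of s).
Proof.
move=> C; rewrite /violation; congr (_ < n).
rewrite -[X in last_sat _ X X](ctx0 C); apply: LastC_spec => // s' sm.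
rewrite (ctx0 C) => lx; have C' := ctx_same sm isT C.
rewrite !holdsE !evalE violation_inner_spec // (lab_same sm).
by rewrite reg_sem_frame // (ctx0 C').
Qed.

Lemma cost_spec s : ctx s ->
  reg (sem CostC s) 37 = \sum_(v < n) repeated n (lab_of s) v.
Proof.
move=> C; rewrite -(ctx0 C); apply: SumC_spec => // s' sm _.
have C' := ctx_same sm isT C.
have [D L] := ctx_sem (c := EarlierC) isT isT C'.
rewrite !holdsE !(eval_Lab _ D) L !evalE (ctx0 D) [reg _ 28]reg_sem_frame //.
rewrite /repeated (lab_same sm) (ctx0 C); congr (_ && (_ < n)).
rewrite -[X in last_sat _ X X](ctx0 C'); apply: LastC_spec => // s2 sm2 _.
have C2 := ctx_same sm2 isT C'.
rewrite sem_Nop !holdsE !(eval_Lab _ C2) !evalE (lab_same sm2) (lab_same sm).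
by have [_ F] := sm2; rewrite [reg s2 28]F.
Qed.

Lemma degree_spec s : ctx s -> reg s 28 < n ->
  reg (sem DegreeC s) 35 = \sum_(u < n) a (reg s 28) u.
Proof.
move=> C lv; rewrite -(ctx0 C); apply: SumC_spec => // s' sm.
rewrite (ctx0 C) => lu; have C' := ctx_same sm isT C.
have [_ F] := sm; have F28 : reg s' 28 = reg s 28 by rewrite F.
by rewrite !holdsE adj_spec ?F28.
Qed.

Lemma init_prog s : ctx s ->
  ctx (sem InitC s) /\ lab_of (sem InitC s) = init n k a (reg s 7).
Proof.
move=> C; rewrite /InitC sem_Then sem_Write !evalE (ctx5 C) (ctx0 C).
have [C0 L0] := ctx_write 0 (leqnn n) C.
have th0 : reg (set_mem s (n * n + n) 0) 7 = reg s 7 by [].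
set s0 := set_mem _ _ _ in C0 L0 th0 *; clearbody s0; set body := Then _ _.
have := @for_ind 28 0 body s0 (fun j s' => [/\ ctx s', reg s' 28 = j,
  reg s' 7 = reg s 7
  & forall v, (v < j) || (n <= v) -> lab_of s' v = init n k a (reg s 7) v]).
rewrite (ctx0 C0); case=> [|j s' ltj [C' ij th' E]|C' _ _ E].
- split=> //; first exact: ctx_set.
  move=> v; rewrite ltn0 orFb => lev; rewrite -[lab_of (set_reg _ _ _)]/(lab_of s0) L0 /init ltnNge lev /=.
  rewrite /update; case: eqP => // /eqP ne; apply: (ctx_clean C).
  by rewrite ltn_neqAle eq_sym ne.
- have [D L] := ctx_sem (c := DegreeC) isT isT C'.
  have r28 : reg (sem DegreeC s') 28 = j by rewrite reg_sem_frame.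
  have r7 : reg (sem DegreeC s') 7 = reg s 7 by rewrite reg_sem_frame.
  have deg := degree_spec C'; rewrite ij in deg; have {}deg := deg ltj.
  rewrite /body sem_Then sem_Cond !holdsE !evalE r7 deg !sem_Write !evalE.
  rewrite (ctx5 D) (ctx2 D) r28 addn1.
  set s2 := sem DegreeC s' in D L r28 r7 *.
  have -> : (if reg s 7 <= \sum_(u < n) a j u
      then set_mem s2 (n * n + j) ((base k).+1 + j) else set_mem s2 (n * n + j) 0)
    = set_mem s2 (n * n + j) (init n k a (reg s 7) j).
    by rewrite /init ltj; case: ifP.
  have [D3 L3] := ctx_write (init n k a (reg s 7) j) (ltnW ltj) D.
  have v3 : reg (set_mem s2 (n * n + j) (init n k a (reg s 7) j)) 28 = j by [].
  have th3 : reg (set_mem s2 (n * n + j) (init n k a (reg s 7) j)) 7 = reg s 7 by [].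
  set s3 := set_mem _ _ _ in D3 L3 v3 th3 *; clearbody s3.
  rewrite /incr; split=> //; [exact: ctx_set|by rewrite reg_set v3|].
  move=> v; rewrite -[lab_of (set_reg _ _ _)]/(lab_of s3) L3 L /update ltnS.
  case: eqP => [-> //|/eqP ne]; rewrite leq_eqVlt (negbTE ne); exact: E.
- split=> //; apply: functional_extensionality => v; apply: E.
  by case: ltnP.
Qed.

Lemma repair_loop s : ctx s -> reg s 11 <= N ->
  let s' := sem (For 36 3 RepairC) s in
  [/\ ctx s', (lab_of s', reg s' 11)
      = iter (budget k) (repair n k a) (lab_of s, reg s 11)
    & reg s' 11 <= N].
Proof.
move=> C leN /=.
have := @for_ind 36 3 RepairC s (fun j s' => [/\ ctx s',
  (lab_of s', reg s' 11) = iter j (repair n k a) (lab_of s, reg s 11)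
  & reg s' 11 <= N]).
rewrite (ctx3 C); case=> [|j s' _ [C' E le]|C' E le]; last by split.
  by split=> //; apply: ctx_set.
have [D E' le'] := repair_prog C' le.
by rewrite /incr /= -E -E'; split=> //; apply: ctx_set.
Qed.

Lemma test_prog s : ctx s -> reg s 8 <= n -> reg s 9 <= n -> reg s 10 <= N ->
  ctx (sem TestC s) /\
  (reg (sem TestC s) 12 != 0) = (reg s 12 != 0)
    || accepts n k a (labelling n k a (reg s 7) (reg s 8) (reg s 9) (reg s 10)).
Proof.
move=> C le8 le9 le10.
have keep r c s' : reg s' r = reg s r -> r \notin assigned c -> reg (sem c s') r = reg s r.
  by move=> <-; apply: reg_sem_frame.
rewrite /TestC /labelling sem_Then sem_Asn eval_Reg.
have C1 : ctx (set_reg s 11 (reg s 10)) by apply: ctx_set.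
have t1 : reg (set_reg s 11 (reg s 10)) 11 = reg s 10 by [].
have k1 : [/\ reg (set_reg s 11 (reg s 10)) 7 = reg s 7,
  reg (set_reg s 11 (reg s 10)) 8 = reg s 8,
  reg (set_reg s 11 (reg s 10)) 9 = reg s 9
  & reg (set_reg s 11 (reg s 10)) 12 = reg s 12] by [].
set s1 := set_reg _ _ _ in C1 t1 k1 *; clearbody s1; case: k1 => k7 k8 k9 k12.
rewrite sem_Then; have [C2 L2] := init_prog C1.
have t2 : reg (sem InitC s1) 11 = reg s 10 by rewrite reg_sem_frame.
have := keep _ InitC _ k8 isT; have := keep _ InitC _ k9 isT; have := keep _ InitC _ k12 isT.
rewrite k7 in L2.
set s2 := sem InitC s1 in C2 L2 t2 *; clearbody s2 => {k7} {}k12 {}k9 {}k8.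
rewrite sem_Then; have le2 : reg s2 11 <= N by rewrite t2.
have [C3 E3 le3] := repair_loop C2 le2; rewrite L2 t2 in E3; rewrite -E3.
have := keep _ (For 36 3 RepairC) _ k8 isT; have := keep _ (For 36 3 RepairC) _ k9 isT;
have := keep _ (For 36 3 RepairC) _ k12 isT.
set s3 := sem (For 36 3 RepairC) s2 in C3 E3 le3 *; clearbody s3 => {}k12 {}k9 {}k8.
rewrite sem_Then sem_Write !evalE (ctx5 C3) k8 /=.
have [C4 L4] := ctx_write 0 le8 C3; rewrite -L4.
have k4 : [/\ reg (set_mem s3 (n * n + reg s 8) 0) 9 = reg s 9,
  reg (set_mem s3 (n * n + reg s 8) 0) 12 = reg s 12
  & reg (set_mem s3 (n * n + reg s 8) 0) 11 = reg s3 11] by [].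
set s4 := set_mem _ _ _ in C4 L4 k4 *; clearbody s4; case: k4 => {}k9 {}k12 t4.
rewrite sem_Then; have le4 : reg s4 11 <= N by rewrite t4.
have [C5 E5 le5] := repair_loop C4 le4; rewrite t4 in E5; rewrite -E5.
have := keep _ (For 36 3 RepairC) _ k9 isT; have := keep _ (For 36 3 RepairC) _ k12 isT.
set s5 := sem (For 36 3 RepairC) s4 in C5 E5 le5 *; clearbody s5 => {}k12 {}k9.
rewrite sem_Then.
have [C6 E6 le6] := relabel_prog (c := Nop) unassigned_spec isT isT isT isT C5 le5.
rewrite -E6.
have := keep _ (RelabelC Nop UnassignedE) _ k9 isT;
have := keep _ (RelabelC Nop UnassignedE) _ k12 isT.
set s6 := sem (RelabelC _ _) s5 in C6 E6 le6 *; clearbody s6 => {}k12 {}k9.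
rewrite sem_Then sem_Write !evalE (ctx5 C6) (ctx3 C6) k9 /= addnn -mul2n.
have [C7 L7] := ctx_write (2 * budget k) le9 C6; rewrite -L7.
have k7 : reg (set_mem s6 (n * n + reg s 9) (2 * budget k)) 12 = reg s 12 /\
  reg (set_mem s6 (n * n + reg s 9) (2 * budget k)) 11 = reg s6 11 by [].
set s7 := set_mem _ _ _ in C7 L7 k7 *; clearbody s7; case: k7 => {}k12 t7.
rewrite sem_Then; have le7 : reg s7 11 <= N by rewrite t7.
have [C8 E8 le8'] := relabel_prog (c := LonelyC) lonely_spec isT isT isT isT C7 le7.
rewrite t7 in E8; rewrite -E8 /=.
have := keep _ (RelabelC LonelyC LonelyE) _ k12 isT.
set s8 := sem (RelabelC _ _) s7 in C8 E8 le8' *; clearbody s8 => {}k12.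
rewrite sem_Then /accepts -violation_spec //.
have := keep _ ViolationC _ k12 isT.
have [C9 L9] := ctx_sem (c := ViolationC) isT isT C8; rewrite -L9.
set s9 := sem ViolationC s8 in C9 L9 *; clearbody s9 => {}k12.
rewrite sem_Then -cost_spec //.
have := keep _ CostC _ k12 isT.
have [C10 _] := ctx_sem (c := CostC) isT isT C9.
have -> : reg s9 34 = reg (sem CostC s9) 34 by rewrite reg_sem_frame.
set s10 := sem CostC s9 in C10 *; clearbody s10 => {}k12.
rewrite sem_Cond !holdsE !evalE (ctx0 C10) (ctx1 C10) sem_Asn sem_Nop evalE -k12.
by case: ifP => acc; [split; [apply: ctx_set|rewrite orbT]|rewrite orbF].
Qed.

End Context.

(** If each round keeps the answer in register 12 or raises it, the loop computes a disjunction over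
    its index; four nested uses yield the existential quantifiers over the guesses. *)
Lemma for_or i b c s m (Inv : state -> Prop) (P : nat -> Prop) :
  i != 12 -> i \notin assigned c -> reg s b = m -> Inv s ->
  (forall s' x, Inv s' -> Inv (set_reg s' i x)) ->
  (forall s', Inv s' -> reg s' i < m -> Inv (sem c s') /\
     (reg (sem c s') 12 != 0 <-> reg s' 12 != 0 \/ P (reg s' i))) ->
  Inv (sem (For i b c) s) /\
  (reg (sem (For i b c) s) 12 != 0 <->
   reg s 12 != 0 \/ exists2 j, j < m & P j).
Proof.
move=> i12 ic <- I0 Iset IS; rewrite eq_sym in i12.
have := @for_ind i b c s (fun j s' => [/\ Inv s', reg s' i = j &
  (reg s' 12 != 0 <-> reg s 12 != 0 \/ exists2 q, q < j & P q)]).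
case=> [|j s' ltj [I' ij E]|I' _ E].
- split; [exact: Iset|by rewrite reg_set eqxx|rewrite reg_set (negbTE i12)].
  by split; [left|case=> // -[]].
- rewrite -ij in ltj; have [I2 E2] := IS _ I' ltj.
  split; first exact: Iset.
    by rewrite reg_set eqxx reg_sem_frame // ij.
  rewrite reg_set (negbTE i12) E2 E ij; split.
    case=> [[h|[q lq Pq]]|Pj]; [by left|right|right; by exists j].
    by exists q; rewrite // ltnW.
  case=> [h|[q]]; first by left; left.
  rewrite ltnS leq_eqVlt => /orP [/eqP -> Pj|lq Pq]; first by right.
  by left; right; exists q.
- by split.
Qed.

Lemma search_prog n k N a s : ctx n k N a s -> reg s 12 = 0 ->
  reg (sem SearchC s) 12 != 0 <->
  exists th w g tau, [/\ th <= n, w <= n, g <= n, tau < N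
    & accepts n k a (labelling n k a th w g tau)].
Proof.
move=> C r12.
have I1 : ctx n k N a s := C.
have [] := @for_or 7 6 (For 8 6 (For 9 6 (For 10 4 TestC))) s n.+1 (ctx n k N a)
  (fun th => exists2 w, w < n.+1 & exists2 g, g < n.+1 & exists2 tau, tau < N &
     accepts n k a (labelling n k a th w g tau)) isT isT (ctx6 C) C.
- by move=> s' x; apply: ctx_set.
- move=> s1 C1 lt1.
  have [|||[D _] E] := @for_or 8 6 (For 9 6 (For 10 4 TestC)) s1 n.+1
    (fun s' => ctx n k N a s' /\ reg s' 7 = reg s1 7)
    (fun w => exists2 g, g < n.+1 & exists2 tau, tau < N &
     accepts n k a (labelling n k a (reg s1 7) w g tau)) isT isT (ctx6 C1); [by []| | |by split].
    by move=> s' x [C' h]; split; [apply: ctx_set|].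
  move=> s2 [C2 h2] lt2.
  have [|||[D [h7 h8]] E] := @for_or 9 6 (For 10 4 TestC) s2 n.+1
    (fun s' => ctx n k N a s' /\ (reg s' 7 = reg s1 7 /\ reg s' 8 = reg s2 8))
    (fun g => exists2 tau, tau < N &
     accepts n k a (labelling n k a (reg s1 7) (reg s2 8) g tau)) isT isT (ctx6 C2);
     [by []| | |by split].
    by move=> s' x [C' h]; split; [apply: ctx_set|].
  move=> s3 [C3 [h3 h3']] lt3.
  have [|||[D [h7 [h8 h9]]] E] := @for_or 10 4 TestC s3 N
    (fun s' => ctx n k N a s' /\ (reg s' 7 = reg s1 7 /\ (reg s' 8 = reg s2 8
       /\ reg s' 9 = reg s3 9)))
    (fun tau => accepts n k a (labelling n k a (reg s1 7) (reg s2 8) (reg s3 9) tau))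
    isT isT (ctx4 C3); [by []| | |by split].
    by move=> s' x [C' h]; split; [apply: ctx_set|].
  move=> s4 [C4 [h7 [h8 h9]]] lt4.
  have [|||C5 E] := test_prog C4; [by rewrite h8|by rewrite h9|exact: ltnW|].
  split; first by split=> //; rewrite !reg_sem_frame.
  by rewrite E -h7 -h8 -h9; split=> /orP.
move=> _ ->; rewrite r12 eqxx /=; split.
  case=> // -[th lth [w lw [g lg [tau lt acc]]]].
  by exists th, w, g, tau.
move=> [th [w [g [tau [l1 l2 l3 l4 acc]]]]]; right.
by exists th => //; exists w => //; exists g => //; exists tau.
Qed.

Lemma nth_allpairs_mul (S T R : Type) (h : S -> T -> R) x0 y0 z0 s t i j :
  i < size s -> j < size t ->
  nth z0 [seq h x y | x <- s, y <- t] (i * size t + j)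
  = h (nth x0 s i) (nth y0 t j).
Proof.
elim: s i => // x s IH [|i] /= lti ltj; rewrite nth_cat size_map.
  by rewrite mul0n add0n ltj (nth_map y0).
rewrite mulSn -addnA ltnNge leq_addr /= addKn; exact: IH.
Qed.

(** * Input, constants and answer *)

Definition input_adj (n : nat) (e : rel 'I_n) (i j : nat) : bool :=
  mem (input_state e 0) (i * n + j) != 0.

Lemma input_adjE n (e : rel 'I_n) (i j : 'I_n) : input_adj e i j = e i j.
Proof.
rewrite /input_adj /=.
have := @nth_allpairs_mul _ _ _ (fun i j => nat_of_bool (e i j)) i j 0
  (enum 'I_n) (enum 'I_n) i j.
rewrite size_enum_ord => -> //; rewrite !nth_ord_enum; by case: (e i j).
Qed.

(** Free of loops, hence of constant cost also when [n <= k]. Register 38 holds the number of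
    digits, and register 40 is nonzero exactly if [k < n]; the costly power in register 4 is
    computed only in that case. *)
Definition ConstantsC : cmd :=
  Then (Asn 3 (Plus (Plus (Plus (Reg 1) (Reg 1)) (Plus (Reg 1) (Reg 1)))
                    (Plus (Plus (Reg 1) (Reg 1)) (Lit 2))))
  (Then (Asn 2 (Plus (Plus (Reg 3) (Reg 3)) (Lit 1)))
  (Then (Asn 6 (Plus (Reg 0) (Lit 1)))
  (Then (Asn 38 (Plus (Plus (Reg 3) (Reg 3)) (Plus (Plus (Reg 3) (Reg 3))
                                                   (Plus (Reg 3) (Reg 3)))))
  (Then (Asn 40 (Minus (Reg 0) (Reg 1)))
  (Then (Asn 12 (Lit 0)) (Then (Asn 5 (Lit 0)) (Asn 4 (Lit 1)))))))).

Definition BoundsC : cmd :=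
  Then (For 13 0 (Asn 5 (Plus (Reg 5) (Reg 0))))
    (For 36 38 (Then (Asn 39 (Lit 0))
      (Then (For 13 2 (Asn 39 (Plus (Reg 39) (Reg 4)))) (Asn 4 (Reg 39))))).

Definition AnswerC : cmd := Asn 0 (Reg 12).

Definition split_identification_prog : prog :=
  Seq (compile ConstantsC 41)
    (If 40 (Seq (compile BoundsC 41)
             (Seq (compile SearchC 41) (compile AnswerC 41)))
           (Const 0 1)).

Lemma constants_spec s : let s' := sem ConstantsC s in
  [/\ [/\ reg s' 0 = reg s 0, reg s' 1 = reg s 1, reg s' 2 = base (reg s 1)
        & reg s' 3 = budget (reg s 1)],
      [/\ reg s' 4 = 1, reg s' 5 = 0, reg s' 6 = (reg s 0).+1 & reg s' 12 = 0],
      reg s' 38 = 6 * budget (reg s 1), reg s' 40 = reg s 0 - reg s 1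
    & mem s' = mem s].
Proof.
rewrite /ConstantsC 7!sem_Then.
have asn r x t : reg (sem (Asn r x) t) r = eval x t by rewrite sem_Asn reg_set eqxx.
set s1 := sem (Asn 3 _) s.
have f1 r : r != 3 -> reg s1 r = reg s r by move=> h; rewrite reg_sem_frame // inE.
have h3 : reg s1 3 = budget (reg s 1) by rewrite asn !evalE /budget; lia.
have m1 : mem s1 = mem s by [].
clearbody s1; set s2 := sem (Asn 2 _) s1.
have f2 r : r != 2 -> reg s2 r = reg s1 r by move=> h; rewrite reg_sem_frame // inE.
have h2 : reg s2 2 = base (reg s 1) by rewrite asn !evalE h3 /base; lia.
have m2 : mem s2 = mem s by [].
clearbody s2; set s3 := sem (Asn 6 _) s2.
have f3 r : r != 6 -> reg s3 r = reg s2 r by move=> h; rewrite reg_sem_frame // inE.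
have h6 : reg s3 6 = (reg s 0).+1 by rewrite asn !evalE f2 // f1 // addn1.
have m3 : mem s3 = mem s by [].
clearbody s3; set s4 := sem (Asn 38 _) s3.
have f4 r : r != 38 -> reg s4 r = reg s3 r by move=> h; rewrite reg_sem_frame // inE.
have h38 : reg s4 38 = 6 * budget (reg s 1).
  by rewrite asn !evalE f3 // f2 // h3; lia.
have m4 : mem s4 = mem s by [].
clearbody s4; set s5 := sem (Asn 40 _) s4.
have f5 r : r != 40 -> reg s5 r = reg s4 r by move=> h; rewrite reg_sem_frame // inE.
have h40 : reg s5 40 = reg s 0 - reg s 1.
  by rewrite asn !evalE !f4 // !f3 // !f2 // !f1.
have m5 : mem s5 = mem s by [].
clearbody s5; rewrite !sem_Asn !evalE !reg_set /= /update /=.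
by rewrite h40 !f5 // h38 !f4 // h6 !f3 // h2 !f2 // h3 !f1.
Qed.

Lemma bounds_spec s : reg s 4 = 1 -> reg s 5 = 0 ->
  reg (sem BoundsC s) 5 = reg s 0 * reg s 0 /\
  reg (sem BoundsC s) 4 = reg s 2 ^ reg s 38.
Proof.
move=> h4 h5; rewrite /BoundsC sem_Then.
set c1 := For 13 0 _; set c2 := For 36 38 _.
split.
  rewrite reg_sem_frame //.
  have := @for_ind 13 0 (Asn 5 (Plus (Reg 5) (Reg 0))) s
    (fun j s' => reg s' 5 = j * reg s 0 /\ reg s' 0 = reg s 0).
  case=> [|j s' _ [E E0]|-> //]; first by rewrite !reg_set.
  by rewrite /incr sem_Asn !evalE !reg_set /= E E0 mulSn addnC.
have f r : r \notin assigned c1 -> reg (sem c1 s) r = reg s r by exact: reg_sem_frame.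
have := @for_ind 36 38 (Then (Asn 39 (Lit 0))
      (Then (For 13 2 (Asn 39 (Plus (Reg 39) (Reg 4)))) (Asn 4 (Reg 39)))) (sem c1 s)
    (fun j s' => reg s' 4 = reg s 2 ^ j /\ reg s' 2 = reg s 2).
rewrite [reg (sem c1 s) 38]f //.
case=> [|j s' _ [E E2]|-> //]; first by rewrite !reg_set /= !f.
rewrite /incr !sem_Then !sem_Asn !evalE !reg_set /=.
set s1 := set_reg s' 39 0.
have e4 : reg s1 4 = reg s 2 ^ j by rewrite -E.
have e2 : reg s1 2 = reg s 2 by rewrite -E2.
have e39 : reg s1 39 = 0 by [].
clearbody s1; split; last by rewrite reg_sem_frame.
have := @for_ind 13 2 (Asn 39 (Plus (Reg 39) (Reg 4))) s1
  (fun i s' => reg s' 39 = i * reg s 2 ^ j /\ reg s' 4 = reg s 2 ^ j).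
rewrite e2; case=> [|i s2 _ [h39 h4']|-> _]; first by rewrite !reg_set /= e39 e4.
  by rewrite /incr sem_Asn !evalE !reg_set /= h39 h4' mulSn addnC.
by rewrite expnS.
Qed.

Lemma bounds_ctx n (e : rel 'I_n) k :
  let s := sem BoundsC (sem ConstantsC (input_state e k)) in
  ctx n k (base k ^ (6 * budget k)) (input_adj e) s /\ reg s 12 = 0.
Proof.
have [[c0 c1 c2 c3] [c4 c5 c6 c12] c38 c40 m] := constants_spec (input_state e k).
set s1 := sem ConstantsC _ in c0 c1 c2 c3 c4 c5 c6 c12 c38 c40 m *.
have [b5 b4] := bounds_spec c4 c5.
have m2 : mem (sem BoundsC s1) = mem (input_state e k) by rewrite mem_sem_frame.
split; last by rewrite reg_sem_frame.
split; rewrite ?b5 ?b4 ?m2.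
- by rewrite reg_sem_frame // c0.
- by rewrite reg_sem_frame // c1.
- by rewrite reg_sem_frame // c2.
- by rewrite reg_sem_frame // c3.
- by rewrite c2 c38.
- by rewrite c0.
- by rewrite reg_sem_frame // c6.
- by [].
- move=> v ltv; rewrite /= nth_default // size_allpairs size_enum_ord.
  exact: leq_addr.
Qed.

Lemma search_correct n (e : rel 'I_n) (e_sym : symmetric e) (e_irr : irreflexive e) k s :
  ctx n k (base k ^ (6 * budget k)) (input_adj e) s -> reg s 12 = 0 ->
  reg (sem SearchC s) 12 != 0 <-> split_identification (SGraph e_sym e_irr) k.
Proof.
move=> C r12; rewrite (search_prog C r12); split.
  move=> [th [w [g [tau [_ _ _ _ acc]]]]].
  have := accepts_sound (@input_adjE n e) acc.
  exact: (@solution_split_identification (SGraph e_sym e_irr)).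
case/split_identification_solution => T [Z [f sol]].
exact: (labelling_complete e_sym e_irr (@input_adjE n e) sol).
Qed.

(** * The trivial case of large [k], and the running time *)

Lemma split_identification_large (G : sgraph) k : #|G| <= k -> split_identification G k.
Proof.
move=> le; apply: (@solution_split_identification G k _ setT (fun=> tt)); split.
- by move=> x y; rewrite !inE.
- by move=> x y; rewrite eqxx.
- by rewrite cardsT; apply: leq_trans le (leq_addr _ _).
Qed.

(** There are [36 * k + 12] digits. The power of 12 is charged to [n], since [base k <= 17 * n.+1].
    For the rest, [base k = 12 * k + 5 <= 17 * k <= k ^ 6] if [k >= 2], and 216 is 6 times 36; for
    [k = 1] the constant [17 ^ 36] is needed, and for [k = 0] the exponent vanishes. *)
Lemma tape_bound : exists A, forall n k, k < n ->
  base k ^ (6 * budget k) <= A * k ^ (216 * k) * n.+1 ^ 12.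
Proof.
(* An abstract constant, lest conversion evaluates its powers in unary. *)
have [q qE] : exists q, q = 17 by exists 17.
exists (q ^ 36 * q ^ 12) => n k ltk.
have -> : 6 * budget k = 36 * k + 12 by rewrite /budget; lia.
have leb : base k <= q * n.+1 by rewrite qE /base /budget; lia.
have q0 : 0 < q by rewrite qE.
suff h : base k ^ (36 * k) <= q ^ 36 * k ^ (216 * k).
  have h12 : base k ^ 12 <= q ^ 12 * n.+1 ^ 12 by rewrite -expnMn leq_exp2r.
  by rewrite expnD -[X in _ <= X]mulnA -mulnACA leq_mul.
case: k ltk leb => [|[|k]] ltk leb.
- by rewrite !muln0 !expn0 muln1 expn_gt0 q0.
- by rewrite (exp1n (216 * 1)) !muln1 leq_exp2r // qE.
- have b6 : base k.+2 <= k.+2 ^ 6.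
    apply: leq_trans (_ : 17 * k.+2 <= _); first by rewrite /base /budget; lia.
    rewrite expnSr leq_mul2r; apply/orP; right.
    by apply: (@leq_trans (2 ^ 5)) => //; rewrite leq_exp2r.
  apply: leq_trans (_ : k.+2 ^ (216 * k.+2) <= _).
    have -> : 216 * k.+2 = 6 * (36 * k.+2) by lia.
    by rewrite [X in _ <= X]expnM leq_exp2r.
  by rewrite leq_pmull // expn_gt0 q0.
Qed.

(* 0 ^ 0 = 1, so the factor k ^ (b * k) is 1 for k = 0; n.+1 instead of n    *)
(* only matters for the empty graph, up to the constant a.                   *)
Theorem theorem5p5 :
  exists (p : prog) (a b c : nat),
    solves_in_time p split_identification
      (fun n k : nat => a * k ^ (b * k) * n.+1 ^ c).
Proof.
exists split_identification_prog.
have [E hE] := cmd_time_poly (Then ConstantsC (Then BoundsC (Then SearchC AnswerC))).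
have [A hA] := tape_bound.
(* The running time is at most [U.+2 ^ E.+1] if [k < n], with one factor to spare for the step of
   the test; [A + 3] bounds [U.+2], that is [N + n.+3], up to the factors in [k] and [n]. The second
   summand pays for the case [n <= k]. *)
exists ((A + 3) ^ E.+1 + (cmd_time 0 ConstantsC).+2), (216 * E.+1), (12 * E.+1).
move=> n e e_sym e_irr k; pose s0 := input_state e k.
have pos : 0 < k ^ (216 * E.+1 * k) * n.+1 ^ (12 * E.+1).
  by rewrite muln_gt0 !expn_gt0 /=; case: (k) => [|k'] //=; rewrite ?muln0 ?orbT.
(* Register 41 is the first one that no command mentions; the loop bound is 0 because this part has
   no loop. *)
have [||b /=|b|d1 [s1 [X1 A1 _ T1]]] :=
    @compile_correct 41 0 ConstantsC 41 s0 s0 (leqnn _); [by []| |by []|by []|].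
  by [].
have [[c0 c1 c2 c3] [c4 c5 c6 c12] c38 c40 m] := constants_spec s0.
have r40 : reg s1 40 = n - k by rewrite A1.1 // c40.
have [ltk|lek] := ltnP k n; last first.
  exists (d1 + 2), (set_reg s1 0 1); split.
  - apply: ExecSeq X1 (ExecIfF _ _ (ExecConst _ _ _)).
    by rewrite r40; apply/eqP.
  - split=> // _; apply: split_identification_large.
    by rewrite card_ord.
  - rewrite -mulnA mulnDl; apply: leq_trans (leq_addl _ _).
    apply: leq_trans (leq_pmulr _ pos); lia.
pose N := base k ^ (6 * budget k); pose U := N + n.+1.
have [C r12] := bounds_ctx e k.
have b1 : 1 < base k by rewrite /base /budget; lia.
have leN6 : 6 * budget k <= N.
  apply: ltnW; apply: leq_trans (ltn_expl _ (isT : 1 < 2)) _.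
  by rewrite leq_exp2r // /budget; lia.
have leNb : base k <= N by rewrite -[X in X <= _]expn1 leq_exp2l // /budget; lia.
have [|||d2 [s2 [X2 A2 _ T2]]] :=
    @compile_correct 41 U BoundsC 41 s1 _ (leqnn _) _ A1; [by []| | |].
- by apply/allP.
- move=> b; rewrite !inE /U => /or3P [] /eqP ->; rewrite ?c0 ?c2 ?c38 /=; lia.
have [|||d3 [s3 [X3 A3 _ T3]]] :=
    @compile_correct 41 U SearchC 41 s2 _ (leqnn _) _ A2; [by vm_compute| | |].
- by apply/allP; vm_compute.
- have sub : all (fun b => b \in [:: 0; 3; 4; 6]) (loop_bounds SearchC) by vm_compute.
  move=> b /(allP sub); rewrite !inE.
  by case/or4P=> /eqP ->; rewrite ?(ctx0 C) ?(ctx3 C) ?(ctx4 C) ?(ctx6 C) /U -/N; lia.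
have [|||d4 [s4 [X4 A4 _ T4]]] :=
    @compile_correct 41 U AnswerC 41 s3 _ (leqnn _) _ A3; [by []|by []|by []|].
exists (d1 + (d2 + (d3 + d4)).+1), s4; split.
- apply: ExecSeq X1 (ExecIfT _ _ (ExecSeq X2 (ExecSeq X3 X4))).
  by rewrite r40 -lt0n subn_gt0.
- by rewrite A4.1 // sem_Asn reg_set evalE; apply: search_correct.
have le1 : d1 + (d2 + (d3 + d4)).+1 <= U.+2 ^ E.+1.
  have h := hE U; have p2 : 0 < U.+2 ^ E by rewrite expn_gt0.
  have h2 : d1 + (d2 + (d3 + d4)) <= U.+2 ^ E.
    apply: leq_trans h; apply: leq_add T1 _; apply: leq_add T2 _.
    exact: leq_add T3 T4.
  by rewrite expnS; move: h2 p2; set P := _ ^ _; nia.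
have leU : U.+2 <= (A + 3) * (k ^ (216 * k) * n.+1 ^ 12).
  have := hA n k ltk; rewrite -/N -mulnA mulnDl /U.
  have p1 : 0 < k ^ (216 * k) by rewrite expn_gt0; case: (k) => [|k'] //=; rewrite muln0.
  have p2 : n.+1 <= n.+1 ^ 12 by rewrite -[X in X <= _]expn1 leq_pexp2l.
  have : n.+1 <= k ^ (216 * k) * n.+1 ^ 12 by rewrite (leq_trans p2) // leq_pmull.
  by set P := _ * _ ^ _; move: (A * P) (P) (N) => Q P' M; clear; lia.
apply: leq_trans le1 _; apply: leq_trans (_ : _ <= ((A + 3) * (k ^ (216 * k) * n.+1 ^ 12)) ^ E.+1) _.
  by rewrite leq_exp2r.
rewrite 2!expnMn -!expnM [216 * k * E.+1]mulnAC -[X in _ <= X]mulnA.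
by rewrite leq_mul ?leq_addr.
Qed.
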